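(* The dimer algebra of a Postnikov diagram is invariant, up to isomorphism, under the untwisting and twisting moves and the boundary untwisting and twisting moves: if $D$ and $D'$ are $(k,n)$-Postnikov diagrams and $D'$ is obtained from $D$ by applying one such move, then $A_D\cong A_{D'}$.
   Context: **Combinatorial set-up.** Fix integers $n,k$ with $1\le k\le n-1$. $C$ is the circular graph with vertex set $C_0=\mathbb{Z}_n=\{1,\dots,n\}$, placed clockwise on a circle, and edge set $C_1$, also labelled by $\mathbb{Z}_n$, edge $i$ joining vertices $i-1$ and $i$. $[a,b]$ denotes the closed cyclic interval $a,a+1,\dots,b$ mod $n$. **Postnikov diagrams.** A $(k,n)$-Postnikov diagram $D$ consists of $n$ directed curves (strands) in a disk with $n$ marked points on its boundary, labelled clockwise by $C_1$; strand $i$ starts at marked point $i$ and ends at marked point $i+k$. Axioms: (a1) only two strands can cross at a given point and crossings are transverse; (a2) there are finitely many crossings; (a3) along any strand, the other strands crossing it alternate between crossing left to right and right to left (strands $i-k$ and $i$ are regarded as crossing at marked point $i$); (b1) no strand intersects itself; (b2) if two strands meet at distinct points $U,V$ then one is oriented from $U$ to $V$ and the other from $V$ to $U$. Diagrams are considered up to isotopy fixing the boundary. The connected components of the complement of the strands in the interior of the disk are the regions; each is either alternating (the strands on its boundary alternate in orientation) or oriented (they are all clockwise or all anticlockwise). An alternating region is labelled by the $k$-subset of $C_1$ of strands having it on their left; these labels are distinct. The alternating region along the boundary arc between marked points $j$ and $j+1$ has label $E_j=[j-k+1,j]\subset C_1$. **The dimer model $Q(D)$.** The quiver $Q(D)$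 has vertex set $Q_0(D)$, the set of labels of alternating regions; the boundary vertices are $E_1,\dots,E_n$ and the others are internal. Its arrows $Q_1(D)$ correspond to the crossings of $D$, including the $n$ marked points (which give the boundary arrows; the others are internal arrows). At an interior crossing the arrow goes from the alternating region lying between the two incoming strand ends to the alternating region lying between the two outgoing strand ends; at a marked point the arrow joins the two adjacent boundary alternating regions, from the one next to the incoming strand to the one next to the outgoing strand. The faces $Q_2(D)=Q_2^+\sqcup Q_2^-$ correspond to the oriented regions of $D$ ($Q_2^+$ anticlockwise, $Q_2^-$ clockwise); the boundary $\partial F$ of a face is the oriented cycle of arrows passing through the crossings around that region. **Dimer algebra.** Paths compose from right to left. Each internal arrow $\alpha$ lies in the boundary of exactly one $F^+\in Q_2^+$ and one $F^-\in Q_2^-$; write $\partial F^{\pm}=\alpha p_\alpha^{\pm}$ with $p_\alpha^\pm$ paths from the head to the tail of $\alpha$. The dimer algebra $A_D$ is the quotient of the path algebra $\mathbb{C}Q(D)$ by the relations $p_\alpha^+=p_\alpha^-$ for all internal arrows $\alpha$. **Moves.** *Untwisting move*: suppose a disk in the interior meets $D$ in exactly two oppositely directed strand segments crossing each other exactly twice (so that they bound an oriented two-sided region); replace them, keeping their end points on the boundary of that disk, by two non-crossing segments. *Boundary untwisting move*: suppose that near a marked point, in a neighbourhood meeting no other strands, the strand starting at the marked point and the strand ending there cross exactly once away from the marked point (so together with the marked point they bound an oriented two-sided region); replace the two segments, keeping their end points on the edge of the neighbourhood and at the marked point, by segments meeting only at the marked point. Mirror-image configurations are included. The *twisting* and *boundary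 twisting* moves are the inverses of these. *)

(* Defs.v *)
From HB Require Import structures.
From mathcomp Require Import all_boot all_order all_algebra finmap.
From mathcomp Require Import boolp reals complex monalg.

Set Implicit Arguments.
Unset Strict Implicit.
Unset Printing Implicit Defensive.

Import GRing.Theory.
Local Open Scope ring_scope.
Local Open Scope quotient_scope.

Record quiver := Quiver {
  vertex : finType;
  arrow : finType;
  tail : arrow -> vertex;
  head : arrow -> vertex }.

(* [s] lists the arrows of a path starting at [v] in the order in which they
   are travelled, i.e. from right to left in the usual notation of products. *)
Fixpoint is_path (Q : quiver) (v : vertex Q) (s : seq (arrow Q)) : bool :=
  if s is a :: s' then (tail a == v) && is_path (head a) s' else true.

Record qpath (Q : quiver) := QPath {
  qpath_val : vertex Q * seq (arrow Q);
  _ : is_path qpath_val.1 qpath_val.2 }.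
HB.instance Definition _ Q := [isSub for @qpath_val Q].
HB.instance Definition _ Q := [Choice of qpath Q by <:].

Section Paths.
Variable Q : quiver.
Implicit Types p q : qpath Q.

Definition arrows p : seq (arrow Q) := (val p).2.
Definition source p : vertex Q := (val p).1.
Definition target p : vertex Q := last (source p) (map (@head Q) (arrows p)).

Definition trivial_path (v : vertex Q) : qpath Q :=
  @QPath Q (v, [::]) isT.

(* [path_comp p q] is the path "q, then p" when q ends where p starts. *)
Definition path_comp p q : option (qpath Q) :=
  if target q == source p then insub (source q, arrows q ++ arrows p) else None.

Lemma is_path_cat v (s t : seq (arrow Q)) :
  is_path v (s ++ t) = is_path v s && is_path (last v (map (@head Q) s)) t.
Proof. by elim: s v => //= a s IHs v; rewrite IHs andbA. Qed.

Lemma path_comp_spec p q : target q = source p ->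
  exists2 r : qpath Q, path_comp p q = Some r & val r = (source q, arrows q ++ arrows p).
Proof.
move=> eqpq; rewrite /path_comp eqpq eqxx.
have wf : is_path (source q) (arrows q ++ arrows p).
  rewrite is_path_cat; apply/andP; split; first exact: (valP q).
  by rewrite -/(target q) eqpq; exact: (valP p).
by case: insubP => [r _ <-|]; [exists r | rewrite /= wf].
Qed.

End Paths.

Section LinearExtension.
Variables (K : fieldType) (T : choiceType) (M : lmodType K).

Definition lin_ext (f : T -> M) (x : {malg K[T]}) : M :=
  \sum_(p <- msupp x) x@_p *: f p.

Lemma lin_extw f (d : {fset T}) x : (msupp x `<=` d)%fset ->
  lin_ext f x = \sum_(p <- d) x@_p *: f p.
Proof.
move=> led; rewrite /lin_ext (big_fset_incl _ led) //= => p _ px.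
by rewrite mcoeff_outdom // scale0r.
Qed.

Lemma lin_ext_linear f : linear (lin_ext f).
Proof.
move=> c x y; set d := (msupp x `|` msupp y)%fset.
have lex : (msupp x `<=` d)%fset by apply: fsubsetUl.
have ley : (msupp y `<=` d)%fset by apply: fsubsetUr.
have lexy : (msupp (c *: x + y) `<=` d)%fset.
  apply: fsubset_trans (msuppD_le _ _) _.
  by apply: fsetSU; apply: msuppZ_le.
rewrite (lin_extw _ lex) (lin_extw _ ley) (lin_extw _ lexy) scaler_sumr.
rewrite -big_split /=; apply: eq_bigr => p _.
by rewrite mcoeffD mcoeffZ scalerDl scalerA.
Qed.

HB.instance Definition _ f :=
  GRing.isLinear.Build K {malg K[T]} M _ (lin_ext f) (lin_ext_linear f).

Lemma lin_extU f p : lin_ext f << p >> = f p.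
Proof.
by rewrite /lin_ext msuppU oner_eq0 big_seq_fset1 mcoeffUU scale1r.
Qed.

End LinearExtension.

Lemma malg_ind (K : fieldType) (T : choiceType) (P : {malg K[T]} -> Prop) :
  P 0 -> (forall c x y, P x -> P y -> P (c *: x + y)) ->
  (forall p, P << p >>) -> forall x, P x.
Proof.
move=> P0 PL PU x; rewrite [x]monalgE.
apply: (big_ind P) => // [y z Py Pz|p _].
  by rewrite -[y]scale1r; apply: PL.
suff -> : << x@_p *g p >> = x@_p *: << p >> + 0 :> {malg K[T]} by apply: PL.
rewrite addr0; apply/malgP => q.
by rewrite mcoeffZ !mcoeffU mulrnAr mulr1.
Qed.


Definition path_algebra (K : fieldType) (Q : quiver) := {malg K[qpath Q]}.
HB.instance Definition _ (K : fieldType) (Q : quiver) :=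
  GRing.Lmodule.on (path_algebra K Q).

HB.lock Definition path_elt (K : fieldType) (Q : quiver) (p : qpath Q) :
  path_algebra K Q := << p >>.

Definition path_prod (K : fieldType) (Q : quiver) (p q : qpath Q) : path_algebra K Q :=
  if path_comp p q is Some r then path_elt K r else 0.

HB.lock Definition path_mul (K : fieldType) (Q : quiver) (x y : path_algebra K Q) :
    path_algebra K Q :=
  lin_ext (fun p => lin_ext (fun q => path_prod K p q) y) x.

Section PathAlgebra.
Variables (K : fieldType) (Q : quiver).
Local Notation A := (path_algebra K Q).
Local Notation "[ p ]" := (path_elt K p).
Implicit Types (p q : qpath Q) (x y z : A).
Local Notation path_mul := (@path_mul K Q).
Local Notation path_prod := (path_prod K).

Definition path_one : A := \sum_(v : vertex Q) [trivial_path v].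

Lemma path_algebra_ind (P : A -> Prop) :
  P 0 -> (forall c x y, P x -> P y -> P (c *: x + y)) ->
  (forall p, P [p]) -> forall x, P x.
Proof. by move=> P0 PL PU; apply: malg_ind => // p; move: (PU p); rewrite unlock. Qed.

Lemma lin_ext_path (M : lmodType K) (f : qpath Q -> M) p : lin_ext f [p] = f p.
Proof. by rewrite unlock lin_extU. Qed.

Lemma path_mulPl c x y z : path_mul (c *: x + y) z = c *: path_mul x z + path_mul y z.
Proof. by rewrite unlock; exact: linearP. Qed.

Lemma path_mulPr c x y z : path_mul z (c *: x + y) = c *: path_mul z x + path_mul z y.
Proof.
rewrite unlock /lin_ext scaler_sumr -big_split /=; apply: eq_bigr => p _.
by rewrite -!/(lin_ext _ _) linearP scalerDr !scalerA mulrC.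
Qed.

Lemma path_mul0l x : path_mul 0 x = 0.
Proof. by rewrite unlock; exact: linear0. Qed.

Lemma path_mul0r x : path_mul x 0 = 0.
Proof. by rewrite unlock /lin_ext big1 // => p _; rewrite -/(lin_ext _ _) linear0 scaler0. Qed.

Lemma path_mulU p q : path_mul [p] [q] = path_prod p q.
Proof. by rewrite [path_mul.body]unlock !lin_ext_path. Qed.

Lemma path_mulDl : left_distributive path_mul +%R.
Proof. by move=> x y z; rewrite -[x]scale1r path_mulPl !scale1r. Qed.

Lemma path_mulDr : right_distributive path_mul +%R.
Proof. by move=> x y z; rewrite -[y]scale1r path_mulPr !scale1r. Qed.

Lemma path_mulZl c x y : path_mul (c *: x) y = c *: path_mul x y.
Proof. by rewrite -[c *: x]addr0 path_mulPl path_mul0l addr0. Qed.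

Lemma path_mulZr c x y : path_mul x (c *: y) = c *: path_mul x y.
Proof. by rewrite -[c *: y]addr0 path_mulPr path_mul0r addr0. Qed.

Lemma path_compN p q : target q != source p -> path_comp p q = None.
Proof. by rewrite /path_comp => /negPf ->. Qed.

Lemma path_prodA p q r :
  path_mul [p] (path_prod q r) = path_mul (path_prod p q) [r].
Proof.
have srcE (s t u : qpath Q) : val s = (source t, arrows t ++ arrows u) -> source s = source t.
  by rewrite /source => ->.
have tgtE (s t u : qpath Q) : target t = source u ->
    val s = (source t, arrows t ++ arrows u) -> target s = target u.
  by move=> e E; rewrite /target /source /arrows E /= map_cat last_cat -/(target t) e.
have [e1|n1] := eqVneq (target r) (source q); last first.
  rewrite /path_prod (path_compN n1) path_mul0r.
  have [e2|n2] := eqVneq (target q) (source p); last first.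
    by rewrite (path_compN n2) path_mul0l.
  have [s -> vs] := path_comp_spec e2.
  by rewrite path_mulU /path_prod path_compN // (srcE _ _ _ vs).
have [s Es vs] := path_comp_spec e1.
rewrite {1}/path_prod Es path_mulU.
have [e2|n2] := eqVneq (target q) (source p); last first.
  by rewrite {2}/path_prod (path_compN n2) path_mul0l /path_prod path_compN // (tgtE _ _ _ e1 vs).
have [t Et vt] := path_comp_spec e2.
rewrite {2}/path_prod Et path_mulU /path_prod.
have e3 : target s = source p by rewrite (tgtE _ _ _ e1 vs).
have e4 : target r = source t by rewrite (srcE _ _ _ vt).
have [u -> vu] := path_comp_spec e3; have [w -> vw] := path_comp_spec e4.
congr [_]; apply: val_inj; rewrite vu vw (srcE _ _ _ vs).
by rewrite /arrows vs vt catA.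
Qed.

Lemma path_mulA : associative path_mul.
Proof.
move=> x y z; elim/path_algebra_ind: x => [|c x x' IHx IHx'|p].
- by rewrite !path_mul0l.
- by rewrite !path_mulPl IHx IHx'.
elim/path_algebra_ind: y => [|c y y' IHy IHy'|q].
- by rewrite path_mul0l path_mul0r path_mul0l.
- rewrite (path_mulPl c y y' z) (path_mulPr c y y' [p]).
  by rewrite path_mulPr path_mulPl IHy IHy'.
elim/path_algebra_ind: z => [|c z z' IHz IHz'|r].
- by rewrite !path_mul0r.
- by rewrite !path_mulPr IHz IHz'.
by rewrite !path_mulU path_prodA.
Qed.

Lemma path_mul1l : left_id path_one path_mul.
Proof.
elim/path_algebra_ind => [|c x y IHx IHy|p]; first exact: path_mul0r.
  by rewrite path_mulPr IHx IHy.
have mulE v : path_mul [trivial_path v] [p] = if v == target p then [p] else 0.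
  rewrite path_mulU /path_prod; case: eqVneq => [->|n]; last first.
    by rewrite path_compN // eq_sym.
  have [r -> vr] := @path_comp_spec Q (trivial_path (target p)) p erefl.
  by congr [_]; apply: val_inj; rewrite vr /= cats0; case: (p) => -[].
rewrite /path_one (big_morph (path_mul^~ [p]) (fun x y => path_mulDl x y _) (path_mul0l _)).
by under eq_bigr => v _ do rewrite mulE; rewrite -big_mkcond /= big_pred1_eq.
Qed.

Lemma path_mul1r : right_id path_one path_mul.
Proof.
elim/path_algebra_ind => [|c x y IHx IHy|p]; first exact: path_mul0l.
  by rewrite path_mulPl IHx IHy.
have mulE v : path_mul [p] [trivial_path v] = if v == source p then [p] else 0.
  rewrite path_mulU /path_prod; case: eqVneq => [->|n]; last by rewrite path_compN.
  have [r -> vr] := @path_comp_spec Q p (trivial_path (source p)) erefl.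
  by congr [_]; apply: val_inj; rewrite vr /=; case: (p) => -[].
rewrite /path_one (big_morph (path_mul [p]) (path_mulDr _) (path_mul0r _)).
by under eq_bigr => v _ do rewrite mulE; rewrite -big_mkcond /= big_pred1_eq.
Qed.

HB.instance Definition _ := GRing.Zmodule_isPzRing.Build A
  path_mulA path_mul1l path_mul1r path_mulDl path_mulDr.

Lemma path_scalerAl c x y : c *: (x * y) = (c *: x) * y.
Proof. by rewrite -path_mulZl. Qed.

Lemma path_scalerAr c x y : c *: (x * y) = x * (c *: y).
Proof. by rewrite -path_mulZr. Qed.

End PathAlgebra.

Definition two_sided_ideal (R : pzRingType) (I : R -> Prop) : Prop :=
  [/\ I 0, forall x y, I x -> I y -> I (x - y),
      forall a x, I x -> I (a * x) & forall a x, I x -> I (x * a)].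

Section QuiverAlgebra.
Variables (K : fieldType) (Q : quiver) (rels : qpath Q -> qpath Q -> Prop).
Local Notation A := (path_algebra K Q).
Implicit Types (x y z : A).

Definition relation_ideal x : Prop :=
  forall I : A -> Prop, two_sided_ideal I ->
    (forall p q, rels p q -> I (path_elt K p - path_elt K q)) -> I x.

Lemma relation_ideal_two_sided : two_sided_ideal relation_ideal.
Proof.
split=> [|x y Ix Iy|a x Ix|a x Ix] J JI Jr; have [J0 JB JL JR] := JI => //.
- by apply: JB; [apply: Ix | apply: Iy].
- by apply: JL; apply: Ix.
- by apply: JR; apply: Ix.
Qed.

Let I0 : relation_ideal 0. Proof. by case: relation_ideal_two_sided. Qed.
Let IB x y : relation_ideal x -> relation_ideal y -> relation_ideal (x - y).
Proof. by case: relation_ideal_two_sided => _ + _ _; apply. Qed.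
Let IL a x : relation_ideal x -> relation_ideal (a * x).
Proof. by case: relation_ideal_two_sided => _ _ + _; apply. Qed.
Let IR a x : relation_ideal x -> relation_ideal (x * a).
Proof. by case: relation_ideal_two_sided => _ _ _; apply. Qed.
Let IN x : relation_ideal x -> relation_ideal (- x).
Proof. by rewrite -[- x]sub0r; apply: IB. Qed.
Let ID x y : relation_ideal x -> relation_ideal y -> relation_ideal (x + y).
Proof. by move=> Ix Iy; rewrite -[y]opprK; apply: IB => //; apply: IN. Qed.
Let IZ c x : relation_ideal x -> relation_ideal (c *: x).
Proof. by move=> Ix; rewrite -[x]mul1r path_scalerAl; apply: IL. Qed.

Definition quiver_equiv x y : bool := `[< relation_ideal (x - y) >].

Lemma quiver_equiv_is_equiv : equiv_class_of quiver_equiv.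
Proof.
split=> [x|x y|y x z]; rewrite /quiver_equiv.
- by apply/asboolP; rewrite subrr.
- by apply/asboolP/asboolP => /IN; rewrite opprB.
- by move=> /asboolP xy /asboolP yz; apply/asboolP; rewrite -[x](subrK y) -addrA; apply: ID.
Qed.

Canonical quiver_equiv_equiv := EquivRelPack quiver_equiv_is_equiv.

Definition quiver_algebra := {eq_quot quiver_equiv}.
HB.instance Definition _ := Choice.on quiver_algebra.
HB.instance Definition _ : EqQuotient A quiver_equiv quiver_algebra :=
  EqQuotient.on quiver_algebra.

Definition quiver_proj x : quiver_algebra := \pi_quiver_algebra x.

Lemma quiver_projP x y : quiver_proj x = quiver_proj y <-> relation_ideal (x - y).
Proof.
split=> H; first by apply/asboolP; apply/(@eqmodP _ quiver_equiv_equiv).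
by apply/(@eqmodP _ quiver_equiv_equiv)/asboolP.
Qed.

Let lift1 (f : A -> A) (u : quiver_algebra) := quiver_proj (f (repr u)).
Let lift2 (f : A -> A -> A) (u v : quiver_algebra) :=
  quiver_proj (f (repr u) (repr v)).

Lemma quiver_reprP x : relation_ideal (repr (quiver_proj x) - x).
Proof. by apply/quiver_projP; rewrite /quiver_proj reprK. Qed.

Definition quiver_opp := lift1 -%R.
Definition quiver_add := lift2 +%R.
Definition quiver_mul := lift2 *%R.
Definition quiver_scale (c : K) := lift1 ( *:%R c).

Lemma quiver_oppE x : quiver_opp (quiver_proj x) = quiver_proj (- x).
Proof. by apply/quiver_projP; rewrite -opprD; apply: IN; apply: quiver_reprP. Qed.

Lemma quiver_addE x y : quiver_add (quiver_proj x) (quiver_proj y) = quiver_proj (x + y).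
Proof.
by apply/quiver_projP; rewrite opprD addrACA; apply: ID; apply: quiver_reprP.
Qed.

Lemma quiver_mulE x y : quiver_mul (quiver_proj x) (quiver_proj y) = quiver_proj (x * y).
Proof.
apply/quiver_projP; set x' := repr _; set y' := repr _.
rewrite -[x' * y'](subrK (x * y')) -mulrBl -addrA -mulrBr.
by apply: ID; [apply: IR | apply: IL]; apply: quiver_reprP.
Qed.

Lemma quiver_scaleE c x : quiver_scale c (quiver_proj x) = quiver_proj (c *: x).
Proof. by apply/quiver_projP; rewrite -scalerBr; apply: IZ; apply: quiver_reprP. Qed.

Lemma quiver_projK (u : quiver_algebra) : u = quiver_proj (repr u).
Proof. by rewrite /quiver_proj reprK. Qed.

Let qE := (quiver_oppE, quiver_addE, quiver_mulE, quiver_scaleE).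

Fact quiver_addA : associative quiver_add.
Proof.
move=> u v w; rewrite (quiver_projK u) (quiver_projK v) (quiver_projK w).
by rewrite !qE addrA.
Qed.
Fact quiver_addC : commutative quiver_add.
Proof.
by move=> u v; rewrite (quiver_projK u) (quiver_projK v) !qE addrC.
Qed.
Fact quiver_add0 : left_id (quiver_proj 0) quiver_add.
Proof. by move=> u; rewrite (quiver_projK u) qE add0r. Qed.
Fact quiver_addN : left_inverse (quiver_proj 0) quiver_opp quiver_add.
Proof. by move=> u; rewrite (quiver_projK u) !qE addNr. Qed.

HB.instance Definition _ := GRing.isZmodule.Build quiver_algebra
  quiver_addA quiver_addC quiver_add0 quiver_addN.

Fact quiver_mulA : associative quiver_mul.
Proof.
move=> u v w; rewrite (quiver_projK u) (quiver_projK v) (quiver_projK w).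
by rewrite !qE mulrA.
Qed.
Fact quiver_mul1l : left_id (quiver_proj 1) quiver_mul.
Proof. by move=> u; rewrite (quiver_projK u) qE mul1r. Qed.
Fact quiver_mul1r : right_id (quiver_proj 1) quiver_mul.
Proof. by move=> u; rewrite (quiver_projK u) qE mulr1. Qed.
Fact quiver_mulDl : left_distributive quiver_mul quiver_add.
Proof.
move=> u v w; rewrite (quiver_projK u) (quiver_projK v) (quiver_projK w).
by rewrite !qE mulrDl.
Qed.
Fact quiver_mulDr : right_distributive quiver_mul quiver_add.
Proof.
move=> u v w; rewrite (quiver_projK u) (quiver_projK v) (quiver_projK w).
by rewrite !qE mulrDr.
Qed.

HB.instance Definition _ := GRing.Zmodule_isPzRing.Build quiver_algebra
  quiver_mulA quiver_mul1l quiver_mul1r quiver_mulDl quiver_mulDr.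

Fact quiver_scaleA a b u : quiver_scale a (quiver_scale b u) = quiver_scale (a * b) u.
Proof. by rewrite (quiver_projK u) !qE scalerA. Qed.
Fact quiver_scale1 : left_id 1 quiver_scale.
Proof. by move=> u; rewrite (quiver_projK u) !qE scale1r. Qed.
Fact quiver_scaleDr : right_distributive quiver_scale quiver_add.
Proof.
move=> c u v; rewrite (quiver_projK u) (quiver_projK v).
by rewrite !qE scalerDr.
Qed.
Fact quiver_scaleDl u : {morph quiver_scale^~ u : a b / a + b >-> quiver_add a b}.
Proof.
by move=> a b; rewrite (quiver_projK u) !qE scalerDl.
Qed.

HB.instance Definition _ := GRing.Zmodule_isLmodule.Build K quiver_algebra
  quiver_scaleA quiver_scale1 quiver_scaleDr quiver_scaleDl.

Fact quiver_proj_linear : linear quiver_proj.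
Proof. by move=> c x y; rewrite -quiver_addE -quiver_scaleE. Qed.
HB.instance Definition _ :=
  GRing.isLinear.Build K A quiver_algebra _ quiver_proj quiver_proj_linear.

Fact quiver_proj_monoid_morphism : monoid_morphism quiver_proj.
Proof. by split=> // x y; rewrite -quiver_mulE. Qed.
HB.instance Definition _ :=
  GRing.isMonoidMorphism.Build A quiver_algebra quiver_proj quiver_proj_monoid_morphism.

Lemma quiver_scalerAl c (u v : quiver_algebra) : c *: (u * v) = (c *: u) * v.
Proof.
rewrite (quiver_projK u) (quiver_projK v).
by rewrite -rmorphM -!linearZ -rmorphM path_scalerAl.
Qed.

Lemma quiver_scalerAr c (u v : quiver_algebra) : c *: (u * v) = u * (c *: v).
Proof.
rewrite (quiver_projK u) (quiver_projK v).
by rewrite -rmorphM -!linearZ -rmorphM path_scalerAr.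
Qed.

(* Relations between parallel paths hold in the matrix algebra in which a path
   from u to v acts as the elementary matrix E_vu, so the quotient is nonzero. *)
Hypothesis parallel : forall p q, rels p q ->
  source p = source q /\ target p = target q.
Variable v0 : vertex Q.

#[local] Definition phi : A -> 'M[K]_#|vertex Q| :=
  lin_ext (fun p => delta_mx (enum_rank (target p)) (enum_rank (source p))).

Let phi_linear : linear phi.
Proof. exact: lin_ext_linear. Qed.
HB.instance Definition _ := GRing.isLinear.Build K A _ _ phi phi_linear.

Let phiU p : phi (path_elt K p) = delta_mx (enum_rank (target p)) (enum_rank (source p)).
Proof. exact: lin_ext_path. Qed.

Let phiM x y : phi (x * y) = phi x *m phi y.
Proof.
elim/path_algebra_ind: x => [|c x x' IHx IHx'|p].
- by rewrite mul0r linear0 mul0mx.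
- by rewrite [_ * y]path_mulPl !linearP mulmxDl -scalemxAl -IHx -IHx'.
elim/path_algebra_ind: y => [|c y y' IHy IHy'|q].
- by rewrite mulr0 linear0 mulmx0.
- by rewrite [_ * (_ + _)]path_mulPr !linearP /= IHy IHy'.
rewrite [_ * _]path_mulU /path_prod !phiU.
have [e|n] := eqVneq (target q) (source p); last first.
  by rewrite path_compN // linear0 mul_delta_mx_0 // (inj_eq enum_rank_inj) eq_sym.
have [r -> vr] := path_comp_spec e; rewrite phiU e mul_delta_mx.
congr delta_mx; rewrite /target /source /arrows vr //=.
by rewrite map_cat last_cat -/(target q) e.
Qed.

Lemma quiver_one_neq0 : 1 != 0 :> quiver_algebra.
Proof.
apply/eqP => /quiver_projP; rewrite subr0 => /(_ (fun x => phi x = 0)) H.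
have {H}: phi 1 = 0.
  apply: H; first split=> [|x y|a x|a x].
  - exact: linear0.
  - by rewrite linearB /= => -> ->; rewrite subr0.
  - by rewrite phiM => ->; rewrite mulmx0.
  - by rewrite phiM => ->; rewrite mul0mx.
  by move=> p q /parallel[es et]; rewrite linearB /= !phiU es et subrr.
move/matrixP/(_ (enum_rank v0) (enum_rank v0)).
rewrite linear_sum summxE (bigD1 v0) //= phiU !mxE eqxx /= big1 ?addr0 => [/eqP|v nv].
  by rewrite oner_eq0.
by rewrite phiU mxE /target /= (inj_eq enum_rank_inj) eq_sym (negPf nv).
Qed.

End QuiverAlgebra.

(* A diagram is recorded by its planar map, which determines it up to isotopy
   fixing the boundary.  Marked points are indexed by 'I_n, clockwise, so the
   marked points 1, ..., n are read modulo n and i + 1 is [ordS i].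

   Every point of the diagram (interior crossing or marked point) is passed by
   two strands, and is crossed by one of them from right to left and by the
   other one from left to right; a pass [(v, b)] is the passage through the
   point v of the strand which, at v, sees the other strand crossing it
   - from right to left, if b = false,
   - from left to right, if b = true.
   Thus, if the pass (v, false) goes from west to east, then the pass (v, true)
   goes from south to north.

   At the marked point m, the outgoing strand m and the incoming strand m - k
   are regarded as crossing, by prolonging them outside the disk:
   [boundary_sign m] is the boolean of the pass of the outgoing strand.  It is
   false if, close to m, the outgoing strand lies clockwise from the incoming
   one, and true if it lies anticlockwise from it. *)
Record strand_diagram (n k : nat) := StrandDiagram {
  crossing : finType;
  passes : 'I_n -> seq (crossing * bool);
  boundary_sign : 'I_n -> bool }.

Section StrandDiagram.
Variables (n k : nat) (D : strand_diagram n k).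

Definition point : finType := (crossing D + 'I_n)%type.
Definition strand_end (i : 'I_n) : 'I_n := iter k (@ordS n) i.

Definition strand (i : 'I_n) : seq (point * bool) :=
  (inr i, boundary_sign D i)
    :: rcons [seq (inl p.1, p.2) | p <- passes D i]
             (inr (strand_end i), ~~ boundary_sign D (strand_end i)).

Definition strand_points (i : 'I_n) : seq point := [seq p.1 | p <- strand i].

(* [q] is the pass following [p] along some strand. *)
Definition follows (p q : point * bool) : bool :=
  [exists i, infix [:: p; q] (strand i)].

(* The four germs of regions at v: [(v, d0, d1)] lies between the outgoing
   (di = true) or incoming (di = false) half-strands of the passes (v, false)
   and (v, true).  With the above compass, (v, true, true) is north-east,
   (v, false, true) north-west, (v, false, false) south-west and
   (v, true, false) south-east.  At a marked point, the boundary arcs take the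
   place of the two half-strands which are outside the disk. *)
Definition corner : finType := (point * bool * bool)%type.

(* The corner at the pass [p], next to its outgoing ([d = true]) or incoming
   half-strand, to the left ([s = true]) or to the right of it. *)
Definition side_corner (p : point * bool) (d s : bool) : corner :=
  if p.2 then (p.1, ~~ s, d) else (p.1, d, s).

(* The corners at the marked point m inside the disk and next to the boundary
   arc on the clockwise, resp. anticlockwise, side of m, and the corner outside
   the disk. *)
Definition cw_corner (m : 'I_n) : corner :=
  (inr m, ~~ boundary_sign D m, ~~ boundary_sign D m).
Definition acw_corner (m : 'I_n) : corner :=
  (inr m, boundary_sign D m, boundary_sign D m).
Definition outer_corner (m : 'I_n) : corner :=
  (inr m, boundary_sign D m, ~~ boundary_sign D m).

(* Consecutive corners along one side of a strand segment or boundary arc. *)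
Definition corner_step (c c' : corner) : bool :=
  [|| [exists p, exists q, exists s, [&& follows p q,
         c == side_corner p true s & c' == side_corner q false s]],
      [exists m, (c == cw_corner m) && (c' == acw_corner (ordS m))] |
      [exists m, (c == outer_corner m) && (c' == outer_corner (ordS m))]].

Definition corner_adj : rel corner :=
  [rel c c' | corner_step c c' || corner_step c' c].

(* The regions of the disk, and the exterior of the disk, seen as the sets of
   their corners. *)
Definition region (c : corner) : {set corner} := [set c' | connect corner_adj c c'].

(* At a corner the orientation of the boundary of the region changes exactly
   when both half-strands are outgoing, or both are incoming. *)
Definition alternating (R : {set corner}) : bool :=
  [exists c, R == region c] && [forall c in R, c.1.2 == c.2].

Definition is_postnikov : Prop :=
  [/\ (* planarity: Euler's formula on the sphere for the connected 4-valent
         graph formed by the strands and the boundary circle *)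
      n_comp corner_adj predT = (#|crossing D| + n + 2)%N,
      forall p, (\sum_i count_mem p (passes D i) = 1)%N,
      forall i, sorted [rel p q | p.2 != q.2] (strand i),
      forall i, uniq (strand_points i) &
      forall i j u v, i != j -> u != v ->
        u \in strand_points i -> v \in strand_points i ->
        u \in strand_points j -> v \in strand_points j ->
        (index u (strand_points i) < index v (strand_points i))%N =
        (index v (strand_points j) < index u (strand_points j))%N].

End StrandDiagram.
Arguments follows {n k} D p q.
Arguments corner_step {n k} D c c'.
Arguments corner_adj {n k} D.
Arguments region {n k} D c.

Record postnikov_diagram (n k : nat) := PostnikovDiagram {
  diagram :> strand_diagram n k;
  postnikov_range : (0 < k < n)%N;
  postnikov_axioms : is_postnikov diagram }.

Section Dimer.
Variables (n k : nat) (D : postnikov_diagram n k).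

Lemma follows_alternate p q : follows D p q -> p.2 != q.2.
Proof.
move=> /existsP[i /infixP[s1 [s2 E]]].
have [_ _ /(_ i) + _ _] := postnikov_axioms D; rewrite {}E.
case: s1 => [|a s1] /=; first by case/andP.
by rewrite cat_path => /and3P[_ _ /andP[]].
Qed.

Lemma corner_step_alternate c c' : corner_step D c c' ->
  (c.1.2 == c.2) = (c'.1.2 == c'.2).
Proof.
case/or3P.
- move=> /existsP[p /existsP[q /existsP[s /and3P[/follows_alternate + /eqP-> /eqP->]]]].
  by case: p q => [v []] [w []] //= _; case: s.
- by move=> /existsP[m /andP[/eqP-> /eqP->]] /=; rewrite !eqxx.
- by move=> /existsP[m /andP[/eqP-> /eqP->]] /=; do 2!case: (boundary_sign _ _).
Qed.

Lemma region_alternating c : c.1.2 == c.2 -> alternating (region D c).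
Proof.
move=> altc; apply/andP; split; first by apply/existsP; exists c.
apply/forall_inP => c'; rewrite inE => /connectP[s].
elim: s c altc => [|c1 s IHs] c altc /=; first by move=> _ ->.
move=> /andP[adj path_s]; apply: IHs path_s.
by case/orP: adj => /corner_step_alternate; rewrite altc => // <-.
Qed.

(* Distinct alternating regions have distinct labels, so that the regions
   themselves are taken as the vertices of the quiver. *)
Definition alternating_region : finType := {R : {set corner D} | alternating R}.

Definition tail_region (v : point D) : alternating_region :=
  exist (fun R => is_true (alternating R)) _ (@region_alternating (v, false, false) isT).
Definition head_region (v : point D) : alternating_region :=
  exist (fun R => is_true (alternating R)) _ (@region_alternating (v, true, true) isT).

Definition dimer_quiver : quiver := Quiver tail_region head_region.

(* The crossings around an oriented region having the corners [(v, ~~ s, s)],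
   which is to the left (s = true: anticlockwise) or to the right (s = false:
   clockwise) of all the strands around it, listed along the strands: at v, the
   strand to follow is the one of the pass (v, s). *)
Definition face_boundary (s : bool) (c : seq (point D)) : bool :=
  uniq c && cycle (fun v w => follows D (v, s) (w, ~~ s)) c.

(* The relation p_alpha^+ = p_alpha^-, for an internal arrow alpha. *)
Definition dimer_relation (p q : qpath dimer_quiver) : Prop :=
  exists x : crossing D, let alpha : arrow dimer_quiver := inl x in
    [/\ source p = head alpha /\ target p = tail alpha,
        source q = head alpha /\ target q = tail alpha,
        face_boundary true (alpha :: arrows p) &
        face_boundary false (alpha :: arrows q)].

Variable K : fieldType.

Definition dimer_algebra := quiver_algebra K dimer_relation.

Lemma dimer_one_neq0 : 1 != 0 :> quiver_algebra K dimer_relation.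
Proof.
apply: quiver_one_neq0 => [p q [x /= [[-> ->] [-> ->] _ _]] //|].
by case/andP: (postnikov_range D) => _ /(leq_ltn_trans (leq0n _)) n0;
  exact: (tail_region (inr (Ordinal n0))).
Qed.

HB.instance Definition _ := GRing.PzRing.on dimer_algebra.
HB.instance Definition _ := GRing.Lmodule.on dimer_algebra.
HB.instance Definition _ := GRing.PzSemiRing_isNonZero.Build dimer_algebra dimer_one_neq0.
HB.instance Definition _ := GRing.Lmodule_isLalgebra.Build K dimer_algebra
  (@quiver_scalerAl K dimer_quiver dimer_relation).
HB.instance Definition _ := GRing.Lalgebra_isAlgebra.Build K dimer_algebra
  (@quiver_scalerAr K dimer_quiver dimer_relation).

End Dimer.

Section Moves.
Variables (n k : nat) (D D' : strand_diagram n k).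

Definition relabel (f : crossing D' -> crossing D) (s : seq (crossing D' * bool)) :=
  [seq (f p.1, p.2) | p <- s].

(* D' is obtained from D by an untwisting move: the segments from x to y on
   strand i and from y to x on strand j bound a two-sided oriented region.
   As diagrams are considered up to isotopy, the crossings of D' are identified
   with the remaining crossings of D by means of f. *)
Definition untwisting : Prop :=
  exists (f : crossing D' -> crossing D) (x y : crossing D) (b : bool)
      (i j : 'I_n) (s1 s2 t1 t2 : seq (crossing D * bool)),
  [/\ injective f /\ i != j,
      passes D i = s1 ++ [:: (x, b); (y, ~~ b)] ++ s2 /\
      relabel f (passes D' i) = s1 ++ s2,
      passes D j = t1 ++ [:: (y, b); (x, ~~ b)] ++ t2 /\
      relabel f (passes D' j) = t1 ++ t2,
      forall l, l != i -> l != j -> relabel f (passes D' l) = passes D l &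
      boundary_sign D' =1 boundary_sign D].

(* D' is obtained from D by a boundary untwisting move at the end point m of
   the strand i: the last crossing x of strand i is the first one of strand m.
   Afterwards, the two strands are in the opposite order around m. *)
Definition boundary_untwisting : Prop :=
  exists (f : crossing D' -> crossing D) (x : crossing D)
      (i : 'I_n) (s t : seq (crossing D * bool)),
  let m := strand_end k i in
  [/\ injective f,
      passes D m = (x, ~~ boundary_sign D m) :: s /\
      relabel f (passes D' m) = s,
      passes D i = rcons t (x, boundary_sign D m) /\
      relabel f (passes D' i) = t,
      forall l, l != i -> l != m -> relabel f (passes D' l) = passes D l &
      forall l, boundary_sign D' l = boundary_sign D l (+) (l == m)].

End Moves.

(* Main.v *)
From HB Require Import structures.
From mathcomp Require Import all_boot all_order all_algebra.
From mathcomp Require Import reals complex.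
Require Import Defs.
Set Implicit Arguments.
Unset Strict Implicit.
Unset Printing Implicit Defensive.
Import GRing.Theory.
Local Open Scope ring_scope.

(** Each face of a dimer model is either to the left of the strands around it
    (sign true) or to the right of them (sign false), and every internal arrow
    lies on one face of each sign.  An untwisting move removes a digon, that is,
    a face with two arrows x and y.  The relation at x then says that y equals
    the path w which completes x to its other face, and the relation at y says
    that x equals the path u which completes y to its other face.  Thus x and y
    are redundant generators, and their relations only serve to eliminate them.
    The remaining relations become those of the untwisted diagram: the faces
    x w and y u are merged by the move into the single face w u, so that
    replacing x by u in a path around x w, or y by w in a path around y u, gives
    a path around w u, and all other faces are preserved.  In a boundary
    untwisting move the digon consists of a crossing x and the boundary arrow m,
    which has no relation; only m is eliminated, and x, having lost its relation
    with the digon, becomes the new boundary arrow at the marked point.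

    This elimination of arrows is [reduction_dimer_iso], which is stated for a
    map g of points, from the small diagram to the big one, and a substitution h
    of paths for arrows, from the big quiver to the small one.  It needs three
    combinatorial inputs.  Faces: the points around a face form a cycle of a partial
    injection, so that every face is determined by each of its points
    ([face_boundary_ex], [face_boundary_uniq]); this makes both families of
    relations explicit.  Vertices: an alternating region is known from the ends
    of arrows it contains, and two ends belong to the same region only for the
    reason that they follow each other along a strand or along the boundary
    ([end_region_rect]); this identifies the vertices of the two quivers.
    Strands: those of the small diagram are obtained from those of the big one
    by deleting passes ([deletion]), so that steps between kept points are the
    same in both diagrams.

    The merging of faces in the untwisting move supposes that x w and y u are
    distinct faces, which is a global property of the planar diagram.  It follows
    from Euler's formula: if the two faces were the same, then removing two
    crossings would reduce the number of regions at most by one, instead of two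
    ([untwisted_faces_distinct]). *)

(** * Homomorphisms given by substituting paths for arrows *)

Definition path_end (Q : quiver) (v : vertex Q) (s : seq (arrow Q)) : vertex Q :=
  last v (map (@head Q) s).

Lemma path_end_cat (Q : quiver) (v : vertex Q) s t :
  path_end v (s ++ t) = path_end (path_end v s) t.
Proof. by rewrite /path_end map_cat last_cat. Qed.

Lemma path_elt_cons (K : fieldType) (Q : quiver) (p q r : qpath Q) :
  target q = source p -> val r = (source q, arrows q ++ arrows p) ->
  path_elt K r = path_elt K p * path_elt K q.
Proof.
move=> e vr; rewrite [_ * _]path_mulU /path_prod.
by have [t -> vt] := path_comp_spec e; congr path_elt; apply: val_inj; rewrite vr vt.
Qed.

Section Substitution.
Variables (Q Q' : quiver) (phi : vertex Q -> vertex Q') (h : arrow Q -> seq (arrow Q')).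
Hypothesis phi_bij : bijective phi.
Hypothesis h_path : forall a : arrow Q, is_path (phi (tail a)) (h a).
Hypothesis h_end : forall a : arrow Q, path_end (phi (tail a)) (h a) = phi (head a).

Definition subst_arrows (s : seq (arrow Q)) : seq (arrow Q') := flatten (map h s).

Lemma subst_arrows_cat s t : subst_arrows (s ++ t) = subst_arrows s ++ subst_arrows t.
Proof. by rewrite /subst_arrows map_cat flatten_cat. Qed.

Lemma subst_arrows_is_path v s : is_path v s ->
  is_path (phi v) (subst_arrows s) /\ path_end (phi v) (subst_arrows s) = phi (path_end v s).
Proof.
elim: s v => //= a s IHs v /andP[/eqP <- /IHs[ps es]].
rewrite -(cat1s a s) subst_arrows_cat !path_end_cat -es -h_end /subst_arrows /= cats0; split=> //.
by rewrite is_path_cat h_path /= -[is_path _ _]/(is_path (path_end _ _) _) h_end.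
Qed.

Fact path_subst_subproof (p : qpath Q) :
  is_path (phi (source p), subst_arrows (arrows p)).1 (phi (source p), subst_arrows (arrows p)).2.
Proof. exact: (subst_arrows_is_path (valP p)).1. Qed.

Definition path_subst (p : qpath Q) : qpath Q' := QPath (path_subst_subproof p).

Lemma path_subst_target p : target (path_subst p) = phi (target p).
Proof. exact: (subst_arrows_is_path (valP p)).2. Qed.

Variable K : fieldType.

Definition path_hom : path_algebra K Q -> path_algebra K Q' :=
  lin_ext (fun p => path_elt K (path_subst p)).

Fact path_hom_linear : linear path_hom.
Proof. exact: lin_ext_linear. Qed.
HB.instance Definition _ := GRing.isLinear.Build K _ _ _ path_hom path_hom_linear.

Lemma path_homU p : path_hom (path_elt K p) = path_elt K (path_subst p).
Proof. exact: lin_ext_path. Qed.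

Lemma path_homM : {morph path_hom : x y / x * y}.
Proof.
move=> x y; elim/path_algebra_ind: x => [|c x x' IHx IHx'|p].
- by rewrite mul0r !linear0 mul0r.
- by rewrite mulrDl -path_scalerAl !linearP /= IHx IHx' mulrDl -path_scalerAl.
elim/path_algebra_ind: y => [|c y y' IHy IHy'|q].
- by rewrite mulr0 !linear0 mulr0.
- by rewrite mulrDr -path_scalerAr !linearP /= IHy IHy' mulrDr -path_scalerAr.
rewrite [_ * _ in LHS]path_mulU /path_prod !path_homU.
have [e|n] := eqVneq (target q) (source p); last first.
  rewrite path_compN // linear0 [_ * _]path_mulU /path_prod path_compN //.
  by rewrite path_subst_target (inj_eq (bij_inj phi_bij)).
have [r -> vr] := path_comp_spec e; rewrite path_homU.
apply: path_elt_cons; first by rewrite path_subst_target e.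
by rewrite /= /source /arrows vr /= subst_arrows_cat.
Qed.

Lemma path_hom1 : path_hom 1 = 1.
Proof.
rewrite linear_sum /= [RHS](reindex phi) /=; last exact: onW_bij.
by apply: eq_bigr => v _; rewrite path_homU; congr path_elt; apply: val_inj.
Qed.

Variables (rels : qpath Q -> qpath Q -> Prop) (rels' : qpath Q' -> qpath Q' -> Prop).
Hypothesis hom_rels : forall p q, rels p q ->
  quiver_proj rels' (path_elt K (path_subst p)) = quiver_proj rels' (path_elt K (path_subst q)).

Definition quiver_hom (u : quiver_algebra K rels) : quiver_algebra K rels' :=
  quiver_proj rels' (path_hom (repr u)).

(** The elements sent into the ideal of the target by [path_hom] form a two-sided
    ideal, so that it suffices to look at the relations themselves. *)
Lemma quiver_homE x : quiver_hom (quiver_proj rels x) = quiver_proj rels' (path_hom x).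
Proof.
apply/quiver_projP; rewrite -linearB /=.
have /(_ (fun z => relation_ideal rels' (path_hom z))) := quiver_reprP (rels := rels) x; apply.
  have [I0 IB IL IR] := @relation_ideal_two_sided K Q' rels'.
  split=> [|y z|a y|a y]; rewrite ?linear0 ?linearB ?path_homM //; first exact: IB.
  - exact: IL.
  - exact: IR.
by move=> p q /hom_rels /quiver_projP; rewrite linearB /= !path_homU.
Qed.

Fact quiver_hom_linear : linear quiver_hom.
Proof.
move=> c u v; rewrite (quiver_projK u) (quiver_projK v).
by rewrite -linearP !quiver_homE !linearP.
Qed.

Fact quiver_hom_monoid : monoid_morphism quiver_hom.
Proof.
split; first by rewrite -[1 in LHS](rmorph1 (quiver_proj rels)) quiver_homE path_hom1 rmorph1.
move=> u v; rewrite (quiver_projK u) (quiver_projK v).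
by rewrite -rmorphM !quiver_homE path_homM rmorphM.
Qed.

End Substitution.

Definition arrow_path (Q : quiver) (a : arrow Q) : qpath Q :=
  @QPath Q (tail a, [:: a]) (introT andP (conj (eqxx _) isT)).

(** A path is the product of its arrows, taken in the opposite order, and of the
    trivial path at its source. *)
Lemma eq_on_paths (K : fieldType) (Q : quiver) (B : pzRingType) (F G : path_algebra K Q -> B) :
  {morph F : x y / x * y} -> {morph G : x y / x * y} ->
  (forall v, F (path_elt K (trivial_path v)) = G (path_elt K (trivial_path v))) ->
  (forall a, F (path_elt K (arrow_path a)) = G (path_elt K (arrow_path a))) ->
  forall p, F (path_elt K p) = G (path_elt K p).
Proof.
move=> FM GM FGv FGa [[v s] ps].
elim: s v ps => [|a s IHs] v ps.
  by have -> : QPath ps = trivial_path v by apply: val_inj.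
have /andP[/eqP va ps'] : is_path v (a :: s) := ps.
have -> : path_elt K (QPath ps) = path_elt K (@QPath Q (head a, s) ps') * path_elt K (arrow_path a).
  by apply: path_elt_cons; rewrite // /source /= va.
by rewrite FM GM FGa IHs.
Qed.

(** * Passes along the strands and faces *)

Section Faces.
Variables (n k : nat) (D : postnikov_diagram n k).
Implicit Types (p q : point D * bool) (v w : point D).

Lemma strand_end_inj : injective (@strand_end n k).
Proof.
by rewrite /strand_end; elim: k => [|j IHj] i1 i2 /= => [|/ordS_inj /IHj].
Qed.

Lemma strand_end_neq (i : 'I_n) : strand_end k i != i.
Proof.
have /andP[k0 kn] := postnikov_range D.
have E j : val (iter j (@ordS n) i) = ((i + j) %% n)%N.
  elim: j => [|j IHj]; first by rewrite addn0 modn_small.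
  by rewrite iterS /= IHj -addn1 modnDml addn1 addnS.
apply/eqP => /(congr1 val); rewrite /= /strand_end E => /eqP.
rewrite -[X in _ == X](modn_small (ltn_ord i)) -[X in _ == (X %% _)%N]addn0 eqn_modDl.
by rewrite mod0n modn_small // eqn0Ngt k0.
Qed.

Lemma strand_uniq i : uniq (strand D i).
Proof. by have [_ _ _ U _] := postnikov_axioms D; apply: map_uniq (U i). Qed.

Lemma pass_strand_crossing i (c : crossing D) (s : bool) :
  ((inl c, s) \in strand D i) = ((c, s) \in passes D i).
Proof.
rewrite inE /= mem_rcons inE /=.
have inj : injective (fun p : crossing D * bool => (inl p.1 : point D, p.2)).
  by move=> [a1 b1] [a2 b2] /= [-> ->].
by rewrite -[(inl c, s)]/((fun p : crossing D * bool => (inl p.1 : point D, p.2)) (c, s)) (mem_map inj).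
Qed.

Lemma pass_strand_marked i m (s : bool) : ((inr m, s) \in strand D i) =
  (s == boundary_sign D m) && (m == i) || (s != boundary_sign D m) && (m == strand_end k i).
Proof.
rewrite inE mem_rcons inE.
have -> : ((inr m, s) \in [seq (inl r.1 : point D, r.2) | r <- passes D i]) = false.
  by apply/negP => /mapP[].
rewrite orbF !xpair_eqE !(inj_eq (@inr_inj _ _)).
congr orb; first by case: eqVneq => [->|_]; rewrite ?andbT ?andbF.
case: eqVneq => [->|_]; rewrite ?andbT ?andbF //=.
by case: s (boundary_sign _ _) => [] [].
Qed.

Lemma pass_strand_ex p : exists i, p \in strand D i.
Proof.
case: p => [[c|m] s].
  have [_ /(_ (c, s)) count_cs _ _ _] := postnikov_axioms D.
  suff /existsP[i ics] : [exists i, (c, s) \in passes D i].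
    by exists i; rewrite pass_strand_crossing.
  apply: contra_eqT count_cs; rewrite negb_exists => /forallP cs0.
  by rewrite big1 // => i _; apply/count_memPn.
have [e|ne] := eqVneq s (boundary_sign D m).
  by exists m; rewrite pass_strand_marked e !eqxx.
have [j _ jm] : bijective (@strand_end n k) by apply: injF_bij; apply: strand_end_inj.
by exists (j m); rewrite pass_strand_marked (negPf ne) jm eqxx.
Qed.

Lemma pass_strand_inj i j p : p \in strand D i -> p \in strand D j -> i = j.
Proof.
case: p => [[c|m] s]; last first.
  rewrite !pass_strand_marked; case: (s == _) => /=; rewrite ?orbF.
    by move=> /eqP <- /eqP.
  by move=> /eqP -> /eqP /strand_end_inj.
rewrite !pass_strand_crossing => ci cj; apply/eqP/negPn/negP => ij.
have [_ /(_ (c, s)) count_cs _ _ _] := postnikov_axioms D.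
have := count_cs; rewrite (bigD1 i) //= (bigD1 j) 1?eq_sym //= => E.
move: ci cj E; rewrite -!has_pred1 !has_count.
by case: (count _ _) => // a _; case: (count _ _) => // b _; rewrite !addSn !addnS.
Qed.

Lemma followsP p q : reflect (exists i s1 s2, strand D i = s1 ++ [:: p, q & s2]) (follows D p q).
Proof.
apply: (iffP existsP) => [[i /infixP[s1 [s2 E]]]|[i [s1 [s2 E]]]].
  by exists i, s1, s2.
by exists i; apply/infixP; exists s1, s2.
Qed.

(** Every pass occurs exactly once on exactly one strand, whence the successor and
    the predecessor of a pass are unique. *)
Lemma follows_fun p q q' : follows D p q -> follows D p q' -> q = q'.
Proof.
move=> /followsP[i [s1 [s2 E]]] /followsP[j [t1 [t2 E']]].
have ij : i = j.
  by apply: (@pass_strand_inj _ _ p); rewrite ?E ?E' mem_cat mem_head orbT.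
have := strand_uniq i; move: E'; rewrite -{}ij {}E => /eqP E' U.
by move: E'; rewrite uniq_eqseq_pivotl // => /andP[_ /eqP[]].
Qed.

Lemma follows_inj p p' q : follows D p q -> follows D p' q -> p = p'.
Proof.
move=> /followsP[i [s1 [s2 E]]] /followsP[j [t1 [t2 E']]].
have ij : i = j.
  by apply: (@pass_strand_inj _ _ q); rewrite ?E ?E' mem_cat !inE eqxx !orbT.
have := strand_uniq i; move: E'; rewrite -{}ij {}E -(cat_rcons p) -(cat_rcons p') => /eqP E' U.
by move: E'; rewrite uniq_eqseq_pivotl // => /andP[/eqP/rcons_inj[]].
Qed.

(** The step around the face of sign [s]: leave [v] along the strand having this
    face on the given side, and arrive at [w] along the strand seen there with the
    opposite sign, since crossings alternate. *)
Definition face_step (s : bool) : rel (point D) :=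
  fun v w => follows D (v, s) (w, ~~ s).

Lemma follows_face_step p q : follows D p q -> face_step p.2 p.1 q.1.
Proof.
move=> pq; have := follows_alternate pq; move: pq; rewrite /face_step.
by case: p q => [v s] [w [] ] /=; case: s.
Qed.

Lemma face_step_ex (s : bool) v :
  (if v is inr m then s == boundary_sign D m else true) -> exists w, face_step s v w.
Proof.
move=> vs; have [i vi] := pass_strand_ex (v, s).
suff [q /follows_face_step] : exists q, follows D (v, s) q by exists q.1.
have : (v, s) != (inr (strand_end k i), ~~ boundary_sign D (strand_end k i)).
  case: v vs {vi} => [//|m] /eqP ->; apply/eqP => -[->].
  by case: boundary_sign.
have : last (v, s) (strand D i) = (inr (strand_end k i), ~~ boundary_sign D (strand_end k i)).
  by rewrite /= last_rcons.
have [s1 [s2 E]] : exists s1 s2, strand D i = s1 ++ (v, s) :: s2.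
  by case/splitPr: vi => s1 s2; exists s1, s2.
rewrite E; case: s2 E => [|q s2] E; first by rewrite last_cat /= => -> /eqP.
by move=> _ _; exists q; apply/followsP; exists i, s1, s2.
Qed.

Lemma face_step_fun (s : bool) v w w' : face_step s v w -> face_step s v w' -> w = w'.
Proof. by move=> vw /(follows_fun vw)[]. Qed.

Lemma face_step_inj (s : bool) v v' w : face_step s v w -> face_step s v' w -> v = v'.
Proof. by move=> vw /(follows_inj vw)[]. Qed.

Lemma follows_into_marked p m (d : bool) :
  follows D p (inr m, d) -> d = ~~ boundary_sign D m.
Proof.
move=> /followsP[i [s1 [s2 E]]].
have : (inr m, d) \in strand D i by rewrite E mem_cat !inE eqxx !orbT.
rewrite pass_strand_marked => /orP[|/andP[+ _]]; last by case: d (boundary_sign _ _) {E} => [] [].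
move=> /andP[/eqP dm /eqP mi]; subst i.
have := strand_uniq m; move: E; rewrite /strand dm.
case: s1 => [[_ ->]|a s1 [_ ->]]; first by rewrite /= inE eqxx.
by rewrite /= mem_cat !inE eqxx !orbT.
Qed.

Lemma follows_from_marked q m (d : bool) :
  follows D (inr m, d) q -> d = boundary_sign D m.
Proof.
move=> /followsP[i [s1 [s2 E]]].
have : (inr m, d) \in strand D i by rewrite E mem_cat !inE eqxx !orbT.
rewrite pass_strand_marked => /orP[/andP[/eqP -> _] //|/andP[dm /eqP mi]].
have {}dm : d = ~~ boundary_sign D m by case: d (boundary_sign _ _) dm {E} => [] [].
have := congr1 (last q) E; rewrite last_cat /= last_rcons -mi -dm => L.
have := strand_uniq i; rewrite E cat_uniq /= => /and3P[_ _ /andP[+ _]].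
by rewrite L mem_last.
Qed.

Lemma follows_neq p q : follows D p q -> p.1 != q.1.
Proof.
move=> /followsP[i [s1 [s2 E]]].
have [_ _ _ /(_ i) U _] := postnikov_axioms D.
move: U; rewrite /strand_points E map_cat cat_uniq /= => /and3P[_ _ /andP[+ _]].
by rewrite in_cons negb_or => /andP[].
Qed.

(** A face which enters a marked point also leaves it: the incoming strand of sign
    [~~ s] there is paired with an outgoing one of sign [s]. *)
Lemma face_step_next (s : bool) v w : face_step s v w -> exists u, face_step s w u.
Proof.
case: w => [c|m] vw; first exact: face_step_ex.
apply: face_step_ex; apply/eqP.
by have := follows_into_marked vw => /negb_inj.
Qed.

(** Both lists follow the same deterministic walk until its first return to [v]. *)
Lemma face_boundary_uniq (s : bool) v c1 c2 :
  face_boundary s (v :: c1) -> face_boundary s (v :: c2) -> c1 = c2.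
Proof.
suff gen u : v \notin c1 -> v \notin c2 ->
    path (face_step s) u (rcons c1 v) -> path (face_step s) u (rcons c2 v) -> c1 = c2.
  by move=> /andP[/= /andP[v1 _] path1] /andP[/= /andP[v2 _]]; apply: gen path1.
elim: c1 c2 u => [|x c1 IHc] [|y c2] u //=.
- by move=> _ v2 /andP[uv _] /andP[uy _]; move: v2; rewrite (face_step_fun uv uy) mem_head.
- by move=> v1 _ /andP[ux _] /andP[uv _]; move: v1; rewrite (face_step_fun uv ux) mem_head.
rewrite !inE !negb_or => /andP[_ v1] /andP[_ v2] /andP[ux path1] /andP[uy path2].
have xy := face_step_fun ux uy; subst y; congr (_ :: _).
exact: IHc path1 path2.
Qed.

Lemma face_boundary_catC (s : bool) (c1 c2 : seq (point D)) :
  face_boundary s (c1 ++ c2) = face_boundary s (c2 ++ c1) :> bool.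
Proof. by rewrite /face_boundary uniq_catC -(rot_size_cat c1) rot_cycle. Qed.

(** If [w] were on the face of [v], then rotating that face to start at [w] would
    give the face of [w] and put [v] on it. *)
Lemma face_boundary_disjoint (s : bool) v c w c' :
  face_boundary s (v :: c) -> face_boundary s (w :: c') -> v \notin w :: c' -> w \notin c.
Proof.
move=> fv fw vw; apply/negP => wc; case/splitPr: wc fv => c1 c2.
rewrite -cat_cons face_boundary_catC cat_cons => /(face_boundary_uniq fw) E.
by move: vw; rewrite E inE mem_cat mem_head !orbT.
Qed.

(** The only marked points without a face of sign [s] are those whose corner of
    this sign is outside the disk.  Extended by the identity where there is no
    successor, [face_step] is a permutation, and the face of [v] is its orbit. *)
Lemma face_boundary_ex (s : bool) v :
  (if v is inr m then s == boundary_sign D m else true) ->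
  exists c, face_boundary s (v :: c).
Proof.
move=> /face_step_ex v_next.
pose next u := odflt u [pick w | face_step s u w].
have nextP u w : face_step s u w -> next u = w.
  move=> uw; rewrite /next; case: pickP => [w' /(face_step_fun uw)-> //|/(_ w)].
  by rewrite uw.
have next_inj : injective next.
  have next_id u : (forall w, ~ face_step s u w) -> next u = u.
    by move=> u0; rewrite /next; case: pickP => // w /u0.
  have case_next u : (exists w, face_step s u w) \/ (forall w, ~ face_step s u w).
    have [/existsP|u0] := boolP [exists w, face_step s u w]; first by left.
    by right=> w uw; case/existsP: u0; exists w.
  move=> u1 u2; have [[w1 s1]|n1] := case_next u1; have [[w2 s2]|n2] := case_next u2.
  - by rewrite (nextP _ _ s1) (nextP _ _ s2) => e; subst w2; apply: face_step_inj s1 s2.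
  - by rewrite (nextP _ _ s1) (next_id _ n2) => e; subst w1; have [w /n2] := face_step_next s1.
  - by rewrite (nextP _ _ s2) (next_id _ n1) => e; subst w2; have [w /n1] := face_step_next s2.
  - by rewrite !next_id.
have E : orbit next v = v :: behead (orbit next v).
  by have := in_orbit next v; rewrite /orbit -orderSpred.
exists (behead (orbit next v)); rewrite -E /face_boundary orbit_uniq /=.
pose P := [pred u | [exists w, face_step s u w]].
apply: (@sub_in_cycle _ P (frel next)) (cycle_orbit next_inj v).
  by move=> u w /existsP[w' uw'] _ /eqP <-; rewrite (nextP _ _ uw').
apply/allP => u; rewrite -fconnect_orbit => /iter_findex <-.
elim: (findex next v u) => [|j /existsP[w vw]]; first exact/existsP.
by apply/existsP; rewrite iterS (nextP _ _ vw); apply: face_step_next vw.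
Qed.

End Faces.

(** * Alternating regions *)

Section Regions.
Variables (n k : nat) (D : postnikov_diagram n k).

Lemma connect_corner_sym : connect_sym (corner_adj D).
Proof. by apply: sym_connect_sym => c c'; rewrite /corner_adj /= orbC. Qed.

Lemma connect_corner_step c c' : corner_step D c c' -> connect (corner_adj D) c c'.
Proof. by move=> cc'; apply: connect1; rewrite /corner_adj /= cc'. Qed.

Lemma connect_side_corner p q s : follows D p q ->
  connect (corner_adj D) (side_corner p true s) (side_corner q false s).
Proof.
move=> pq; apply: connect_corner_step; apply/or3P/Or31.
by apply/existsP; exists p; apply/existsP; exists q; apply/existsP; exists s; rewrite pq !eqxx.
Qed.

(** The alternating regions are parametrized by the ends of the arrows, so that
    heads and tails can be treated alike. *)
Definition end_region (a : point D * bool) : alternating_region D :=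
  if a.2 then head_region a.1 else tail_region a.1.

Lemma end_regionE a : val (end_region a) = region D (a.1, a.2, a.2).
Proof. by case: a => v []. Qed.

Lemma end_region_eq a b :
  (end_region a == end_region b) = connect (corner_adj D) (a.1, a.2, a.2) (b.1, b.2, b.2).
Proof.
rewrite -val_eqE /= !end_regionE; apply/eqP/idP => [E|ab].
  by move/setP/(_ (b.1, b.2, b.2)): E; rewrite !inE connect0.
by apply/setP => c; rewrite !inE (same_connect connect_corner_sym ab).
Qed.

Lemma end_region_step s v w : face_step s v w -> end_region (v, true) = end_region (w, false).
Proof.
move=> vw; apply/eqP; rewrite end_region_eq /=.
by have := connect_side_corner (~~ s) vw; case: s {vw}.
Qed.

Lemma end_region_boundary m : end_region (inr m, ~~ boundary_sign D m) =
  end_region (inr (ordS m), boundary_sign D (ordS m)).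
Proof.
apply/eqP; rewrite end_region_eq; apply: connect_corner_step; apply/or3P/Or32.
by apply/existsP; exists m; rewrite !eqxx.
Qed.

Lemma end_region_surj R : exists a, end_region a = R.
Proof.
case: R => R altR; have [/existsP[[[v d0] d1] /eqP E] /forall_inP alt] := andP altR.
have /alt /= /eqP d01 : (v, d0, d1) \in R by rewrite E inE.
by exists (v, d1); apply: val_inj; rewrite end_regionE /= E d01.
Qed.

(** Walking around a region, one passes from one alternating corner to the next
    along a strand segment, which leads from the head of an arrow to the tail of
    the next one on a face, or along a boundary arc. *)
Lemma end_region_rect (T : Type) (F : point D * bool -> T) :
  (forall s v w, face_step s v w -> F (v, true) = F (w, false)) ->
  (forall m, F (inr m, ~~ boundary_sign D m) = F (inr (ordS m), boundary_sign D (ordS m))) ->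
  forall a b, end_region a = end_region b -> F a = F b.
Proof.
move=> Fstep Fbd.
have Fcorner c c' : corner_step D c c' -> c.1.2 == c.2 -> F (c.1.1, c.2) = F (c'.1.1, c'.2).
  case/or3P.
  - move=> /existsP[p /existsP[q /existsP[t /and3P[pq /eqP-> /eqP->]]]].
    have := Fstep _ _ _ (follows_face_step pq); have := follows_alternate pq.
    by case: p q pq => v [] [w []] //= pq _; case: t.
  - by move=> /existsP[m /andP[/eqP-> /eqP->]] _; apply: Fbd.
  - by move=> /existsP[m /andP[/eqP-> /eqP->]] /=; case: boundary_sign.
move=> [v d] [w d'] /eqP; rewrite end_region_eq => /connectP[/= cs].
suff gen c : c.1.2 == c.2 -> path (corner_adj D) c cs -> forall c', c' = last c cs ->
    F (c.1.1, c.2) = F (c'.1.1, c'.2).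
  by move=> path_cs E; apply: (gen (v, d, d) _ path_cs _ E); rewrite /= eqxx.
elim: cs c => [|c1 cs IHcs] c alt /=; first by move=> _ _ ->.
move=> /andP[adj path_cs] c' E.
have [-> alt1] : F (c.1.1, c.2) = F (c1.1.1, c1.2) /\ c1.1.2 == c1.2.
  case/orP: adj => [st|st]; have A := corner_step_alternate st.
    by split; [apply: Fcorner | rewrite -A].
  by rewrite (Fcorner _ _ st) A.
exact: (IHcs c1).
Qed.

Lemma end_region_lift (T : Type) (F : point D * bool -> T) :
  (forall s v w, face_step s v w -> F (v, true) = F (w, false)) ->
  (forall m, F (inr m, ~~ boundary_sign D m) = F (inr (ordS m), boundary_sign D (ordS m))) ->
  exists f : alternating_region D -> T, forall a, f (end_region a) = F a.
Proof.
move=> Fstep Fbd.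
have exR R : exists a, end_region a == R by have [a <-] := end_region_surj R; exists a.
exists (fun R => F (xchoose (exR R))) => a.
by apply: end_region_rect => //; apply/eqP; apply: (xchooseP (exR (end_region a))).
Qed.

(** Opening a face at [v] gives the path which the relation at [v] attaches to that
    face. *)
Lemma face_boundary_path s v c : face_boundary s (v :: c) ->
  is_path (Q := dimer_quiver D) (head_region v) c /\
  path_end (Q := dimer_quiver D) (head_region v) c = tail_region v.
Proof.
move=> /andP[_ /= path_c].
suff gen u : path (face_step s) u (rcons c v) ->
    is_path (Q := dimer_quiver D) (head_region u) c /\
    path_end (Q := dimer_quiver D) (head_region u) c = tail_region v by exact: gen.
elim: c {path_c} u => [|w c IHc] u /=; first by rewrite andbT => /end_region_step.
move=> /andP[uw /IHc[pc ec]]; split=> //.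
by rewrite pc andbT; apply/eqP/esym/(end_region_step uw).
Qed.

Lemma face_step_connect s v w : face_step s v w ->
  connect (corner_adj D) (v, ~~ s, s) (w, ~~ s, s).
Proof. by move=> vw; have := connect_side_corner s vw; case: s {vw}. Qed.

Lemma face_boundary_connect s c v w : face_boundary s c -> v \in c -> w \in c ->
  connect (corner_adj D) (v, ~~ s, s) (w, ~~ s, s).
Proof.
move=> /andP[_ cyc] vc wc.
have {}cyc : cycle (connect (corner_adj D)) [seq (u, ~~ s, s) | u <- c].
  by rewrite cycle_map; apply: sub_cycle cyc => u u'; apply: face_step_connect.
have corner_c u : u \in c -> (u, ~~ s, s) \in [seq (u', ~~ s, s) | u' <- c].
  exact: (map_f (fun u' => (u', ~~ s, s))).
have /connectP[cs path_cs ->] := connect_cycle cyc (corner_c v vc) (corner_c w wc).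
by elim: cs (v, _, _) path_cs => //= c1 cs IHcs c0 /andP[/connect_trans + /IHcs]; apply.
Qed.

End Regions.

(** * Eliminating arrows from a dimer algebra *)

(** Two mutually inverse homomorphisms are recorded, rather than one bijective one,
    since the moves are used in both directions. *)
Definition dimer_iso (K : fieldType) (n k : nat) (D D' : postnikov_diagram n k) : Prop :=
  exists (F : {lrmorphism dimer_algebra D K -> dimer_algebra D' K})
    (G : {lrmorphism dimer_algebra D' K -> dimer_algebra D K}),
  cancel F G /\ cancel G F.

Section DimerAlgebra.
Variables (n k : nat) (D : postnikov_diagram n k) (K : fieldType).

(** The relation at [x] is symmetric in the two faces, so that the side on which
    the digon lies does not matter. *)
Lemma dimer_relation_proj (x : crossing D) (p q : qpath (dimer_quiver D)) (s : bool) :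
  source p = head_region (inl x) -> source q = head_region (inl x) ->
  face_boundary s (inl x :: arrows p) -> face_boundary (~~ s) (inl x :: arrows q) ->
  quiver_proj (@dimer_relation n k D) (path_elt K p) =
  quiver_proj (@dimer_relation n k D) (path_elt K q).
Proof.
move=> sp sq.
wlog -> : p q s sp sq / s = true => [W|fp fq].
  case: s => fp fq; first exact: (W _ _ true).
  by apply/esym; exact: (W _ _ true).
have [_ tp] := face_boundary_path fp; have [_ tq] := face_boundary_path fq.
apply/quiver_projP => I _; apply; exists x; split=> //; split=> //.
  by rewrite /target sp.
by rewrite /target sq.
Qed.

End DimerAlgebra.

Lemma lrmorphism_of (n k : nat) (D D' : postnikov_diagram n k) (K : fieldType)
    (F : dimer_algebra D K -> dimer_algebra D' K) :
  linear F -> monoid_morphism F ->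
  exists G : {lrmorphism dimer_algebra D K -> dimer_algebra D' K}, G =1 F.
Proof.
move=> F_linear F_monoid.
pose linF := GRing.isLinear.Build K _ _ _ F F_linear.
pose monF := GRing.isMonoidMorphism.Build _ _ F F_monoid.
pose G : {lrmorphism dimer_algebra D K -> dimer_algebra D' K} := HB.pack F linF monF.
by exists G.
Qed.

(** [g] embeds the points of the small diagram [D'] into those of [D], and [h]
    expresses every arrow of [D] as a path of [D'].  An arrow of [D] which is not
    kept forms a digon with some crossing [x] ([h_digon]): the relation at [x] is
    what makes it equal to the path given by [h].  The faces at the kept
    crossings correspond under [h] ([faces_g]), and the relation at any other
    crossing becomes trivial ([faces_digon]).  The map [rho] moves an end of an
    arrow of [D] to an end of an arrow of [D'] in the same region; together with
    [g] it identifies the alternating regions. *)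
Section Reduction.
Variables (n k : nat) (D D' : postnikov_diagram n k) (K : fieldType).
Variables (f : crossing D' -> crossing D) (g : point D' -> point D).
Variables (rho : point D * bool -> point D' * bool) (h : point D -> seq (point D')).

Hypothesis g_crossing : forall z, g (inl z) = inl (f z).
Hypothesis g_step : forall s v w, face_step (D := D') s v w ->
  end_region (g v, true) = end_region (g w, false).
Hypothesis g_boundary : forall m, end_region (g (inr m), ~~ boundary_sign D' m) =
  end_region (g (inr (ordS m)), boundary_sign D' (ordS m)).
Hypothesis rho_step : forall s v w, face_step (D := D) s v w ->
  end_region (rho (v, true)) = end_region (rho (w, false)).
Hypothesis rho_boundary : forall m, end_region (rho (inr m, ~~ boundary_sign D m)) =
  end_region (rho (inr (ordS m), boundary_sign D (ordS m))).
Hypothesis rho_g : forall v d, rho (g v, d) = (v, d).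
Hypothesis g_rho : forall a, end_region (g (rho a).1, (rho a).2) = end_region a.
Hypothesis h_g : forall v, h (g v) = [:: v].
Hypothesis h_digon : forall e, (exists v, e = g v) \/
  exists x s, face_boundary s [:: inl x; e] /\
    face_boundary (~~ s) (inl x :: map g (h e)).
Hypothesis faces_g : forall z s, exists Q,
  face_boundary s (inl (f z) :: Q) /\ face_boundary s (inl z :: flatten (map h Q)).
Hypothesis faces_digon : forall c, (exists z, c = f z) \/
  exists t, forall s, exists Q, face_boundary s (inl c :: Q) /\ flatten (map h Q) = t.

Theorem reduction_dimer_iso : dimer_iso K D D'.
Proof.
pose QD := dimer_quiver D; pose QD' := dimer_quiver D'.
have [phi phiE] := end_region_lift (F := fun a => end_region (rho a)) rho_step rho_boundary.
have [psi psiE] := end_region_lift (F := fun a => end_region (g a.1, a.2)) g_step g_boundary.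
have psiK : cancel psi phi.
  move=> R; have [[v d] <-] := end_region_surj R.
  by rewrite psiE phiE rho_g.
have phiK : cancel phi psi.
  by move=> R; have [a <-] := end_region_surj R; rewrite phiE psiE g_rho.
have phi_bij : bijective (phi : vertex QD -> vertex QD') by exists psi.
have psi_bij : bijective (psi : vertex QD' -> vertex QD) by exists phi.
have phi_tail v : phi (tail_region (g v)) = tail_region v.
  by rewrite (phiE (g v, false)) rho_g.
have phi_head v : phi (head_region (g v)) = head_region v.
  by rewrite (phiE (g v, true)) rho_g.
have psi_tail v : psi (tail_region v) = tail_region (g v) := psiE (v, false).
have psi_head v : psi (head_region v) = head_region (g v) := psiE (v, true).
have g_path u l : is_path (Q := QD) u (map g l) -> is_path (Q := QD') (phi u) l /\
    path_end (Q := QD') (phi u) l = phi (path_end (Q := QD) u (map g l)).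
  elim: l u => //= v l IHl u /andP[/eqP <- /IHl].
  by rewrite phi_tail phi_head eqxx.
have h_ok (a : arrow QD) : is_path (Q := QD') (phi (tail a)) (h a) /\
    path_end (Q := QD') (phi (tail a)) (h a) = phi (head a).
  case: (h_digon a) => [[v ->]|[x [s [/andP[_ /= /and3P[xe ex _]] fx]]]].
    by rewrite h_g /= phi_tail phi_head eqxx.
  have [px ex'] := face_boundary_path fx.
  have -> : tail_region a = head_region (inl x) by apply/esym/(end_region_step xe).
  have [-> ->] := g_path _ _ px; split=> //.
  by rewrite ex'; congr phi; apply/esym/(end_region_step ex).
have h_path a := (h_ok a).1; have h_end a := (h_ok a).2.
have g1_path (a : arrow QD') : is_path (Q := QD) (psi (tail a)) [:: g a].
  by rewrite /= psi_tail eqxx.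
have g1_end (a : arrow QD') : path_end (Q := QD) (psi (tail a)) [:: g a] = psi (head a).
  by rewrite /path_end /= psi_head.
pose Phi := path_subst h_path h_end; pose Psi := path_subst g1_path g1_end.
pose proj := quiver_proj (K := K) (@dimer_relation n k D).
pose proj' := quiver_proj (K := K) (@dimer_relation n k D').
have arrows_Phi p : arrows (Phi p) = flatten (map h (arrows p)) by [].
have arrows_Psi p : arrows (Psi p) = map g (arrows p).
  by rewrite /Psi /path_subst /arrows /= /subst_arrows (map_comp (fun x => [:: x]) g) flatten_map1 map_id.
have PhiK p : Phi (Psi p) = p.
  apply: val_inj; case: p => [[v l] pl]; congr (_, _); first exact: psiK.
  rewrite -[LHS]/(arrows (Phi (Psi (QPath pl)))) arrows_Phi arrows_Psi -map_comp.
  by rewrite (eq_map (g := fun v => [:: v])) ?flatten_map1 ?map_id // => w /=; apply: h_g.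
(* The composite of the two homomorphisms replaces each arrow e that is not kept
   by the other side of the relation which eliminates e. *)
have PsiK p : proj (path_elt K (Psi (Phi p))) = proj (path_elt K p).
  have M1 : {morph (fun x => proj (path_hom g1_path g1_end (path_hom h_path h_end x))) : x y / (x * y)%R}.
    by move=> x y; rewrite !path_homM // [proj _]rmorphM.
  have M2 : {morph proj : x y / (x * y)%R} by apply: rmorphM.
  have := eq_on_paths M1 M2 _ _ p; rewrite !path_homU; apply=> [v|a]; rewrite !path_homU.
    by congr proj; congr path_elt; apply: val_inj; rewrite /= phiK.
  have E : arrows (Psi (Phi (arrow_path a))) = map g (h a).
    by rewrite arrows_Psi arrows_Phi /= cats0.
  have S : source (Psi (Phi (arrow_path a))) = tail a by rewrite /source /= phiK.
  case: (h_digon a) => [[v av]|[x [s [fx fx']]]].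
    congr proj; congr path_elt; apply: val_inj; apply/eqP.
    by rewrite [val _]surjective_pairing xpair_eqE -/(source _) -/(arrows _) S E av h_g !eqxx.
  have xa : tail_region a = head_region (inl x).
    by case/andP: fx => _ /= /andP[/end_region_step xa _]; exact: esym xa.
  by apply: (dimer_relation_proj K (x := x) (s := ~~ s)); rewrite ?S ?E ?negbK.
have Phi_rel p q : dimer_relation p q -> proj' (path_elt K (Phi p)) = proj' (path_elt K (Phi q)).
  move=> [c [[sp _] [sq _] fp fq]].
  have [[z cz]|[t Ht]] := faces_digon c; last first.
    congr proj'; congr path_elt; apply: val_inj; apply/eqP.
    rewrite [val (Phi p)]surjective_pairing [val (Phi q)]surjective_pairing xpair_eqE.
    have [Q1 [/(face_boundary_uniq fp) e1 t1]] := Ht true.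
    have [Q2 [/(face_boundary_uniq fq) e2 t2]] := Ht false.
    rewrite -/(arrows (Phi p)) -/(arrows (Phi q)) !arrows_Phi e1 e2 t1 t2 eqxx andbT.
    by rewrite /= sp sq.
  subst c; have [Q1 [/(face_boundary_uniq fp) e1 f1]] := faces_g z true.
  have [Q2 [/(face_boundary_uniq fq) e2 f2]] := faces_g z false.
  have S (r : qpath QD) : source r = head_region (inl (f z)) -> source (Phi r) = head_region (inl z).
    by move=> sr; rewrite -phi_head g_crossing -sr.
  by apply: (dimer_relation_proj K (x := z) (s := true)); rewrite ?S // arrows_Phi ?e1 ?e2.
have Psi_rel p q : dimer_relation p q -> proj (path_elt K (Psi p)) = proj (path_elt K (Psi q)).
  move=> [z [[sp _] [sq _] fp fq]].
  (* As a face is determined by its starting point, every side of a relation of D'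
     is the image under Phi of a side of the relation of D at the same crossing. *)
  have ex s (r : qpath QD') : source r = head_region (inl z) -> face_boundary s (inl z :: arrows r) ->
      exists r', [/\ Phi r' = r, source r' = head_region (inl (f z)) &
        face_boundary s (inl (f z) :: arrows r')].
    move=> sr fr; have [Q [fQ /(face_boundary_uniq fr) EQ]] := faces_g z s.
    have [pQ _] := face_boundary_path fQ.
    exists (@QPath QD (head_region (inl (f z)), Q) pQ); split=> //.
    apply: val_inj; rewrite [val r]surjective_pairing; congr (_, _); last exact: esym EQ.
    by rewrite -[RHS]/(source r) sr -phi_head g_crossing.
  have [p' [<- sp' fp']] := ex _ _ sp fp; have [q' [<- sq' fq']] := ex _ _ sq fq.
  by rewrite !PsiK; apply: (dimer_relation_proj K (x := f z) (s := true)).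
have [F FE] := lrmorphism_of (quiver_hom_linear phi_bij Phi_rel) (quiver_hom_monoid phi_bij Phi_rel).
have [G GE] := lrmorphism_of (quiver_hom_linear psi_bij Psi_rel) (quiver_hom_monoid psi_bij Psi_rel).
have projP c x y : proj (c *: x + y)%R = (c *: proj x + proj y)%R by apply: linearP.
have projP' c x y : proj' (c *: x + y)%R = (c *: proj' x + proj' y)%R by apply: linearP.
exists F, G; split=> u; rewrite FE GE (quiver_projK u).
  rewrite (quiver_homE phi_bij Phi_rel) (quiver_homE psi_bij Psi_rel).
  suff E x : proj (path_hom g1_path g1_end (path_hom h_path h_end x)) = proj x by exact: E.
  elim/path_algebra_ind: x => [|c x y IHx IHy|p].
  - by rewrite !linear0.
  - by rewrite (path_hom_linear h_path h_end) (path_hom_linear g1_path g1_end) [RHS]projP -IHx -IHy; apply: projP.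
  - by rewrite !path_homU; apply: PsiK.
rewrite (quiver_homE psi_bij Psi_rel) (quiver_homE phi_bij Phi_rel).
suff E x : proj' (path_hom h_path h_end (path_hom g1_path g1_end x)) = proj' x by exact: E.
elim/path_algebra_ind: x => [|c x y IHx IHy|p].
- by rewrite !linear0.
- by rewrite (path_hom_linear g1_path g1_end) (path_hom_linear h_path h_end) [RHS]projP' -IHx -IHy; apply: projP'.
- by rewrite !path_homU; congr proj'; congr path_elt; apply: PhiK.
Qed.

End Reduction.

(** * Deleting points of a diagram *)

Lemma infix_filter2 (T : eqType) (P : pred T) (s : seq T) a b :
  P a -> P b -> infix [:: a; b] s -> infix [:: a; b] (filter P s).
Proof.
move=> Pa Pb /infixP[s1 [s2 ->]].
by rewrite !filter_cat /= Pa Pb; apply/infixP; exists (filter P s1), (filter P s2).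
Qed.

Lemma filter_infix2 (T : eqType) (P : pred T) (s : seq T) a b :
  infix [:: a; b] (filter P s) -> exists c, infix [:: a; c] s.
Proof.
elim: s => [|e s IHs] //=; have skip : infix [:: a; b] (filter P s) -> exists c, infix [:: a; c] (e :: s).
  by move=> /IHs[c ac]; exists c; rewrite infix_consl ac orbT.
case: (P e) => //; rewrite infix_consl => /orP[|//].
case: s {IHs skip} => [|c s]; rewrite /= andbC // => /andP[_ /eqP ->].
by exists c; rewrite /= !eqxx prefix0s.
Qed.

Section Deletion.
Variables (n k : nat) (D D' : postnikov_diagram n k) (g : point D' -> point D).
Definition pass_image (a : point D' * bool) : point D * bool := (g a.1, a.2).

Definition deletion := [/\ injective g & forall l,
  map pass_image (strand D' l) = [seq a <- strand D l | a.1 \in codom g]].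
Hypothesis del : deletion.
Let g_inj : injective g. Proof. by case: del. Qed.
Let strand_image l : map pass_image (strand D' l) = [seq a <- strand D l | a.1 \in codom g].
Proof. by case: del. Qed.

Lemma pass_image_inj : injective pass_image.
Proof. by move=> [v d] [w e] [/g_inj -> ->]. Qed.

Lemma deletion_infix l a b :
  infix [:: pass_image a; pass_image b] [seq a <- strand D l | a.1 \in codom g] ->
  follows D' a b.
Proof.
rewrite -strand_image => /infixP[s1 [s2 E]]; apply/existsP; exists l; apply/infixP.
have [s1' [s' [-> E1 {}E]]] : exists s1' s', [/\ strand D' l = s1' ++ s',
    map pass_image s1' = s1 & map pass_image s' = [:: pass_image a, pass_image b & s2]].
  exists (take (size s1) (strand D' l)), (drop (size s1) (strand D' l)).
  by rewrite cat_take_drop map_take map_drop E take_size_cat ?drop_size_cat.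
exists s1'; case: s' E => [|a' [|b' s2']] //= /eqP.
rewrite !eqseq_cons => /and3P[/eqP/pass_image_inj -> /eqP/pass_image_inj -> _].
by exists s2'.
Qed.

Lemma deletion_follows a b :
  follows D (pass_image a) (pass_image b) -> follows D' a b.
Proof.
move=> /existsP[l ab]; apply: (@deletion_infix l).
by apply: infix_filter2; rewrite //= codom_f.
Qed.

(** If the pass of [D] after [a] is kept, then it is [b] by uniqueness; a new step
    therefore bridges deleted passes. *)
Lemma follows_deletion a b : follows D' a b ->
  follows D (pass_image a) (pass_image b) \/
  exists2 c, c.1 \notin codom g & follows D (pass_image a) c.
Proof.
move=> ab; have /existsP[l /infixP[s1 [s2 E]]] := ab.
have [c /= ac] : exists c, infix [:: pass_image a; c] (strand D l).
  apply: (filter_infix2 (P := fun a => a.1 \in codom g) (b := pass_image b)).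
  by rewrite -strand_image E map_cat /=; apply: (infix_infix _ [:: _; _]).
have {}ac : follows D (pass_image a) c by apply/existsP; exists l.
have [/codomP[v cv]|] := boolP (c.1 \in codom g); last by right; exists c.
left; have Ec : c = pass_image (v, c.2) by rewrite /pass_image -cv; case: (c).
by rewrite Ec in ac *; rewrite (follows_fun ab (deletion_follows ac)).
Qed.

Lemma deletion_face_step s v w : face_step s (g v) (g w) -> face_step s v w.
Proof. exact: (@deletion_follows (v, s) (w, ~~ s)). Qed.

Lemma deletion_path s v c : path (face_step s) (g v) (map g c) -> path (face_step s) v c.
Proof. by elim: c v => //= w c IHc v /andP[/deletion_face_step -> /IHc]. Qed.

Lemma codom_seq (c : seq (point D)) : {subset c <= codom g} -> exists c', c = map g c'.
Proof.
elim: c => [|v c IHc] sub; first by exists [::].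
have [w vw] : exists w, v = g w by apply/codomP/sub/mem_head.
have [|c' ->] := IHc; first by move=> u uc; apply: sub; rewrite inE uc orbT.
by exists (w :: c'); rewrite vw.
Qed.

Lemma deletion_face s v c : face_boundary s (g v :: map g c) -> face_boundary s (v :: c).
Proof.
rewrite -map_cons => /andP[]; rewrite (map_inj_uniq g_inj) => Uc path_c.
apply/andP; split=> //=; apply: deletion_path.
by rewrite map_rcons.
Qed.

Definition retract (T : Type) (F : point D' -> T) (F0 : point D -> T) (v : point D) : T :=
  if [pick w | g w == v] is Some w then F w else F0 v.

Lemma retract_image T F F0 v : @retract T F F0 (g v) = F v.
Proof.
by rewrite /retract; case: pickP => [w /eqP/g_inj-> //|/(_ v)]; rewrite eqxx.
Qed.

Lemma retract_notin T F F0 v : v \notin codom g -> @retract T F F0 v = F0 v.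
Proof.
rewrite /retract; case: pickP => [w /eqP <-|//].
by rewrite codom_f.
Qed.

End Deletion.

Section RemovedCrossings.
Variables (n k : nat) (D D' : postnikov_diagram n k) (f : crossing D' -> crossing D).

Lemma passes_inj l l' (p : crossing D * bool) : p \in passes D l -> p \in passes D l' -> l = l'.
Proof. by case: p => c d; rewrite -!pass_strand_crossing; apply: pass_strand_inj. Qed.

Lemma passes_uniq l : uniq (map fst (passes D l)).
Proof.
have [_ _ _ /(_ l) U _] := postnikov_axioms D.
move: U; rewrite /strand_points /= map_rcons => /andP[_].
rewrite rcons_uniq => /andP[_]; rewrite -!map_comp => U.
apply: (@map_uniq _ _ (fun c => inl c : point D)).
by rewrite -map_comp.
Qed.

Lemma passes_ex (c : crossing D) (d : bool) : exists l, (c, d) \in passes D l.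
Proof. by have [l] := pass_strand_ex (inl c, d); exists l; rewrite -pass_strand_crossing. Qed.

(** No strand meets a crossing twice, so that removing a segment from a list of
    passes is the same as removing all passes at its crossings. *)
Lemma filter_segment l (s1 M s2 : seq (crossing D * bool)) : passes D l = s1 ++ M ++ s2 ->
  s1 ++ s2 = [seq p <- passes D l | p.1 \notin map fst M].
Proof.
move=> E; have := passes_uniq l; rewrite {}E !map_cat !filter_cat.
rewrite !cat_uniq has_cat negb_or => /and3P[_ /andP[d1 _] /and3P[_ d2 _]].
have -> : [seq p <- M | p.1 \notin map fst M] = [::].
  apply/eqP; rewrite -[_ == _]negbK -has_filter; apply/hasPn => p pM /=.
  by rewrite negbK map_f.
congr (_ ++ _); apply/esym/all_filterP/allP => p ps.
  by apply/negP => pM; case/hasP: d1; exists p.1; rewrite //= map_f.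
by apply/negP => pM; case/hasP: d2; exists p.1; rewrite //= map_f.
Qed.

Variable E : seq (crossing D).
Hypothesis relabelE : forall l, relabel f (passes D' l) = [seq p <- passes D l | p.1 \notin E].

Lemma kept_crossing c : reflect (exists z, c = f z) (c \notin E).
Proof.
apply: (iffP idP) => [cE|[z ->]].
  have [l cl] := passes_ex c false.
  have : (c, false) \in relabel f (passes D' l) by rewrite relabelE mem_filter cE.
  by case/mapP => -[z d] _ [-> _]; exists z.
have [l /(map_f (fun p => (f p.1, p.2)))] : exists l, (z, false) \in passes D' l.
  by have [l] := pass_strand_ex (D := D') (inl z, false); exists l; rewrite -pass_strand_crossing.
by rewrite -/(relabel _ _) relabelE mem_filter => /andP[].
Qed.

Lemma strand_image (g : point D' -> point D) l : (forall z, g (inl z) = inl (f z)) ->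
  map (pass_image g) (strand D' l) =
  (g (inr l), boundary_sign D' l) ::
    rcons [seq (inl p.1, p.2) | p <- passes D l & p.1 \notin E]
      (g (inr (strand_end k l)), ~~ boundary_sign D' (strand_end k l)).
Proof.
move=> gE; rewrite /strand /= map_rcons -relabelE -!map_comp.
congr (_ :: rcons _ _); apply: eq_map => p.
by rewrite /pass_image /= gE.
Qed.

End RemovedCrossings.

(** * The boundary untwisting move *)

(** After the move the two strands at the marked point m are in the opposite order,
    as they were at the crossing x.  Hence g sends the point m of D' to the point x
    of D, and it is the point m of D that is deleted.  With this choice the faces of
    D' are exactly those of D other than the digon, and both diagrams have the same
    steps between kept points.  The arrow m of D has the ends of the arrow x in the
    opposite order, as the two form the digon. *)
Lemma boundary_untwisting_dimer_iso (K : fieldType) (n k : nat) (D D' : postnikov_diagram n k) :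
  boundary_untwisting D D' -> dimer_iso K D D'.
Proof.
move=> [f [x [i [s [t]]]]] /=; set m := strand_end k i.
set b := boundary_sign D m => -[f_inj [Dm D'm] [Di D'i] Dl bs].
have im : i != m by rewrite eq_sym strand_end_neq.
have relabelE l : relabel f (passes D' l) = [seq p <- passes D l | p.1 \notin [:: x]].
  have [->|li] := eqVneq l i.
    by rewrite D'i -[t]cats0; apply: (filter_segment (M := [:: (x, b)])); rewrite Di cats1.
  have [->|lm] := eqVneq l m.
    by rewrite D'm; apply: (filter_segment (s1 := [::]) (M := [:: (x, ~~ b)])).
  rewrite (Dl _ li lm); apply/esym/all_filterP/allP => -[c d] cl /=.
  rewrite inE; apply: contraNN li => /eqP cx; subst c.
  have [db|db] := eqVneq d b.
    by apply/eqP/(passes_inj cl); rewrite Di mem_rcons db mem_head.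
  case/negP: lm; apply/eqP/(passes_inj cl).
  by rewrite Dm; case: d (b) db {cl} => [] []; rewrite ?mem_head.
pose g (v : point D') : point D :=
  match v with inl z => inl (f z) | inr l => if l == m then inl x else inr l end.
have gm : g (inr m) = inl x by rewrite /g eqxx.
have g_marked l : l != m -> g (inr l) = inr l by rewrite /g => /negPf ->.
have fx z : f z != x.
  have : f z \notin [:: x] by apply/(kept_crossing relabelE); exists z.
  by rewrite inE.
have g_inj : injective g.
  move=> [z1|l1] [z2|l2] /=; do ?case: eqVneq => [->|?]; move=> // -[].
  - by move=> /f_inj ->.
  - by move=> zx; have := fx z1; rewrite zx eqxx.
  - by move=> zx; have := fx z2; rewrite zx eqxx.
  - by move=> ->.
have codom_g v : (v \in codom g) = (v != inr m).
  apply/codomP/idP => [[[z|l] ->]|] //=.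
    by have [//|lm] := eqVneq l m; rewrite (inj_eq (@inr_inj _ _)).
  case: v => [c|l] vm; last first.
    by exists (inr l); rewrite g_marked // -(inj_eq (@inr_inj (crossing D) _)).
  have [->|cx] := eqVneq c x; first by exists (inr m).
  have [z ->] : exists z, c = f z by apply/(kept_crossing relabelE); rewrite inE.
  by exists (inl z).
have gz z : g (inl z) = inl (f z) by [].
clearbody g.
have crossings_kept (ps : seq (crossing D * bool)) :
    [seq a <- [seq (inl p.1 : point D, p.2) | p <- ps] | a.1 \in codom g] =
    [seq (inl p.1 : point D, p.2) | p <- ps].
  by apply/all_filterP/allP => _ /mapP[p _ ->]; rewrite codom_g.
have del : deletion g.
  split=> // l; rewrite (strand_image relabelE _ gz) /strand -rcons_cons filter_rcons.
  rewrite [filter _ (_ :: _)]/= crossings_kept !codom_g !(inj_eq (@inr_inj (crossing D) _)) !bs.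
  have [->|lm] /= := eqVneq l m.
    rewrite gm (negPf (strand_end_neq D m)) g_marked ?(strand_end_neq D m) //=.
    by rewrite -relabelE D'm Dm addbT addbF.
  have [lm'|lm'] /= := eqVneq (strand_end k l) m.
    have -> : l = i by apply: (strand_end_inj lm').
    rewrite -relabelE D'i Di g_marked // -/m gm addbF addbT negbK map_rcons.
    by [].
  rewrite !g_marked //= !addbF -relabelE; have [li|li] := eqVneq l i.
    by case/eqP: lm'; rewrite li.
  by rewrite Dl.
have m_notin : inr m \notin codom g by rewrite codom_g eqxx.
have m_only v : v \notin codom g -> v = inr m by rewrite codom_g negbK => /eqP.
have mx : face_step b (inr m) (inl x).
  apply/existsP; exists m; apply/infixP; exists [::].
  by exists (behead (behead (strand D m))); rewrite /strand Dm.
have xm : face_step b (inl x) (inr m).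
  apply/existsP; exists i; apply/infixP.
  exists ((inr i, boundary_sign D i) :: [seq (inl p.1, p.2) | p <- t]), [::].
  by rewrite /strand Di map_rcons -!cats1 /= -catA.
have digon : face_boundary b [:: inl x; inr m].
  by apply/andP; split=> //; apply/and3P.
have b'E : boundary_sign D' m = ~~ b by rewrite bs eqxx addbT.
have from_m s' v : face_step s' (inr m) v -> s' = b /\ v = inl x.
  move=> mv; have sb : s' = b := follows_from_marked mv.
  by split=> //; rewrite sb in mv; apply: face_step_fun mv mx.
have to_m s' v : face_step s' v (inr m) -> s' = b /\ v = inl x.
  move=> vm; have sb : s' = b by have /negb_inj := follows_into_marked vm.
  by split=> //; rewrite sb in vm; apply: face_step_inj vm xm.
have g_step s' v w : face_step (D := D') s' v w -> face_step (D := D) s' (g v) (g w).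
  move=> vw; have [//|[c /m_only cm /follows_face_step]] := follows_deletion del vw.
  rewrite /= cm => /to_m[s'b gv].
  have {}gv : v = inr m by apply: g_inj; rewrite gm.
  rewrite gv in vw; have : s' = boundary_sign D' m := follows_from_marked vw.
  by rewrite s'b b'E; case: (b).
have [w face_w] := @face_boundary_ex _ _ D (~~ b) (inl x) isT.
have face_kept s' v c : face_boundary s' (g v :: c) -> (s' = b -> v != inr m) ->
    exists c', c = map g c' /\ face_boundary s' (v :: c').
  move=> fc vm.
  have mc : inr m \notin c.
    apply/negP => mc; have [_ cyc] := andP fc.
    have [s'b _] := from_m _ _ (next_cycle cyc (mem_behead (s := g v :: c) mc)).
    subst s'; rewrite -cat1s face_boundary_catC in digon.
    suff : inr m \notin c by rewrite mc.
    apply: face_boundary_disjoint fc digon _.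
    rewrite !inE negb_or -codom_g codom_f -gm (inj_eq g_inj); exact: vm.
  have [u uc|c' Ec] := codom_seq (g := g) (c := c).
    by rewrite codom_g; apply: contraNneq mc => <-.
  by exists c'; split=> //; apply: (deletion_face del); rewrite -Ec.
(* c' completes the new boundary arrow to its face; it is the value of the arrow m. *)
have [c' [Ew face_c']] : exists c', w = map g c' /\ face_boundary (~~ b) (inr m :: c').
  by apply: face_kept; rewrite ?gm //; case: (b).
rewrite {}Ew in face_w.
pose h := retract g (fun v => [:: v]) (fun=> c').
pose rho (a : point D * bool) := retract g (fun v => (v, a.2)) (fun=> (inr m, ~~ a.2)) a.1.
have h_g v : h (g v) = [:: v] := retract_image del _ _ v.
have h_m : h (inr m) = c' := retract_notin _ _ m_notin.
have rho_g v d : rho (g v, d) = (v, d) := retract_image del _ _ v.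
have rho_m d : rho (inr m, d) = (inr m, ~~ d) := retract_notin _ _ m_notin.
have h_map c : flatten (map h (map g c)) = c.
  by rewrite -map_comp (eq_map (g := fun v => [:: v])) ?flatten_map1 ?map_id // => v /=; apply: h_g.
have end_m d : end_region (inl x, ~~ d) = end_region (inr m, d) :> alternating_region D.
  by case: d; [apply/esym/(end_region_step mx) | apply: end_region_step xm].
have end_g_marked l d : end_region (g (inr l), d (+) (l == m)) = end_region (inr l, d).
  by have [->|lm] := eqVneq l m; rewrite ?gm ?addbT ?end_m // g_marked ?addbF.
have rho_marked l d : rho (inr l, d) = (inr l, d (+) (l == m)).
  have [->|lm] := eqVneq l m; first by rewrite rho_m addbT.
  by rewrite -(g_marked l lm) rho_g addbF.
apply: (@reduction_dimer_iso _ _ D D' K f g rho h) => //.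
- by move=> s' v u /g_step; apply: end_region_step.
- move=> l; rewrite !bs -addNb end_g_marked end_g_marked; exact: end_region_boundary.
- move=> s' v u vu.
  have [/codomP[v' Ev]|/m_only Ev] := boolP (v \in codom g); last first.
    by subst v; have [_ ->] := from_m _ _ vu; rewrite -gm rho_g rho_m.
  have [/codomP[u' Eu]|/m_only Eu] := boolP (u \in codom g); last first.
    by subst u; have [_ ->] := to_m _ _ vu; rewrite -gm rho_g rho_m.
  by subst u v; rewrite !rho_g; apply: end_region_step (deletion_face_step del vu).
- move=> l; rewrite !rho_marked addNb -!bs; exact: end_region_boundary.
- move=> [v d]; have [/codomP[v' ->]|/m_only ->] := boolP (v \in codom g).
    by rewrite rho_g.
  by rewrite rho_m gm end_m.
- move=> e; have [/codomP[v ->]|/m_only ->] := boolP (e \in codom g); first by left; exists v.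
  by right; exists x, b; rewrite h_m; split=> //.
- move=> z s'.
  have [Q fQ] := @face_boundary_ex _ _ D s' (inl (f z)) isT; rewrite -gz in fQ.
  have [Q' [EQ fQ']] := face_kept s' (inl z) Q fQ (fun=> isT).
  by exists Q; rewrite EQ h_map -gz -EQ.
- move=> c; have [->|cx] := eqVneq c x; last first.
    by left; apply/(kept_crossing relabelE); rewrite inE.
  right; exists c' => s'; have [->|s'b] := eqVneq s' b.
    by exists [:: inr m]; rewrite /= h_m cats0.
  have {s'b} -> : s' = ~~ b by move: s'b; case: s'; case: (b).
  by exists (map g c'); rewrite h_map.
Qed.

(** * The untwisting move *)

Section TwistedSide.
Variables (n k : nat) (D D' : postnikov_diagram n k) (g : point D' -> point D) (b : bool).

(** One of the two strands of the digon, passing through u and then v: in the big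
    diagram it comes from p and goes on to p', and in the small one p' directly
    follows p.  The digon is the face of sign b, so that the other three steps
    belong to faces of the opposite sign.  The second strand is described by
    exchanging u and v, which makes the whole situation symmetric. *)
Definition twisted_side (u v : point D) (p p' : point D') :=
  [/\ face_step (~~ b) (g p) u, face_step b u v, face_step (~~ b) v (g p') &
      face_step (~~ b) p p'].

Lemma twisted_side_ex (i : 'I_n) (x y : crossing D) s1 s2 : deletion g ->
    (forall v, (v \in codom g) = (v \notin [:: inl x; inl y])) ->
    passes D i = s1 ++ [:: (x, b); (y, ~~ b)] ++ s2 ->
  exists p p', twisted_side (inl x) (inl y) p p'.
Proof.
move=> del codom_g Di.
pose S := [seq (inl c.1 : point D, c.2) | c <- s1].
have [P' [S2 E2]] : exists P' S2, rcons [seq (inl c.1 : point D, c.2) | c <- s2]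
    (inr (strand_end k i), ~~ boundary_sign D (strand_end k i)) = P' :: S2.
  by case: [seq _ | _ <- s2] => [|a l]; eexists; eexists.
pose a0 : point D * bool := (inr i, boundary_sign D i).
have E : strand D i = belast a0 S ++ [:: last a0 S, (inl x, b), (inl y, ~~ b), P' & S2].
  by rewrite -cat_rcons -lastI -E2 /strand Di !map_cat /= rcons_cat.
set P := last a0 S in E; set S1 := belast a0 S in E.
have Px : follows D P (inl x, b) by apply/followsP; exists i, S1; eexists; exact: E.
have xy : follows D (inl x, b) (inl y, ~~ b).
  by apply/followsP; exists i, (rcons S1 P); eexists; rewrite cat_rcons; exact: E.
have yP' : follows D (inl y, ~~ b) P'.
  apply/followsP; exists i, (rcons (rcons S1 P) (inl x, b)); eexists.
  by rewrite !cat_rcons; exact: E.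
have Pb : P.2 = ~~ b by have := follows_alternate Px; move=> /=; case: (P.2) (b) => [] [].
have P'b : P'.2 = b by have := follows_alternate yP'; move=> /=; case: (P'.2) (b) => [] [].
have [_ _ _ /(_ i) U _] := postnikov_axioms D.
have [Pk P'k] : P.1 \in codom g /\ P'.1 \in codom g.
  rewrite !codom_g; move: U; rewrite /strand_points E map_cat cat_uniq => /and3P[_ _] /=.
  rewrite !inE !negb_or => /and4P[/and4P[-> -> _ _] /and3P[_ xP' _] /andP[yP'' _] _].
  by rewrite ![P'.1 == _]eq_sym xP' yP''.
have [/codomP[p Ep] /codomP[p' Ep']] := (Pk, P'k).
exists p, p'; split.
- by have := follows_face_step Px; rewrite Pb Ep.
- exact: (follows_face_step xy).
- by have := follows_face_step yP'; rewrite /= Ep'.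
apply: (deletion_infix del (l := i)).
rewrite E filter_cat /= Pk P'k !codom_g !inE !eqxx !orbT /=.
rewrite negbK /pass_image /= -Ep -Ep' -Pb -{1}P'b -!surjective_pairing.
exact: (infix_infix _ [:: _; _]).
Qed.

End TwistedSide.

Section Untwisting.
Variables (n k : nat) (D D' : postnikov_diagram n k).
Variables (g : point D' -> point D) (x y : point D) (b : bool) (p p' q q' : point D').
Hypothesis del : deletion g.
Hypothesis codom_g : forall v, (v \in codom g) = (v \notin [:: x; y]).
Hypothesis xy_side : twisted_side g b x y p p'.
Hypothesis yx_side : twisted_side g b y x q q'.

Let g_inj : injective g. Proof. by case: del. Qed.

(** The passes before those at x and y come from p and q or from y and x; hence p
    and q are the only kept points that lose their successor. *)
Lemma untwisted_step s v w : face_step (D := D') s v w ->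
  face_step (D := D) s (g v) (g w) \/
  s = ~~ b /\ (v = p /\ w = p' \/ v = q /\ w = q').
Proof.
move=> vw; have [|[c cxy /follows_face_step]] := follows_deletion del vw; first by left.
rewrite /=; set u := c.1 in cxy *; move=> vu; right.
have [px xy yp' pp'] := xy_side; have [qy yx xq' qq'] := yx_side.
have gv z : z \notin codom g -> g v = z -> False by move=> + gz; rewrite -gz codom_f.
have xg : x \notin codom g by rewrite codom_g mem_head.
have yg : y \notin codom g by rewrite codom_g !inE eqxx orbT.
have sb : s = ~~ b.
  apply/eqP; apply: contraT => sb; have {sb} Es : s = b by move: sb; case: (s); case: (b).
  subst s; move: cxy; rewrite codom_g negbK !inE => /orP[] /eqP uE; rewrite uE in vu.
    by case: (gv _ yg (face_step_inj vu yx)).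
  by case: (gv _ xg (face_step_inj vu xy)).
subst s; split=> //; move: cxy; rewrite codom_g negbK !inE => /orP[] /eqP uE; rewrite uE in vu.
  have vp := g_inj (face_step_inj vu px); rewrite vp in vw *.
  by left; split=> //; apply: face_step_fun vw pp'.
have vq := g_inj (face_step_inj vu qy); rewrite vq in vw *.
by right; split=> //; apply: face_step_fun vw qq'.
Qed.

Hypothesis g_marked : forall l, g (inr l) = inr l.
Hypothesis boundary_signE : boundary_sign D' =1 boundary_sign D.

Let corner_image (c : corner D') : corner D := (g c.1.1, c.1.2, c.2).

Lemma side_corner_image a d t :
  corner_image (side_corner a d t) = side_corner (pass_image g a) d t.
Proof. by case: a => v []. Qed.

(** On one side of the new strand segment is an alternating region, which contains
    the tail of u and the head of v because u and v form a digon.  On the other side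
    is the merged face, and there the faces at u and v are supposed to coincide. *)
Lemma twisted_side_corner u v r r' t : twisted_side g b u v r r' -> face_step b v u ->
  connect (corner_adj D) (u, b, ~~ b) (v, b, ~~ b) ->
  connect (corner_adj D) (side_corner (g r, ~~ b) true t) (side_corner (g r', b) false t).
Proof.
move=> [ru uv vr' _] vu uv_conn.
have ru' := connect_side_corner t ru; rewrite negbK in ru'.
have vr'' := connect_side_corner t vr'; rewrite negbK in vr''.
apply: connect_trans ru' (connect_trans _ vr'').
have /eqP := end_region_step vu; rewrite end_region_eq /= connect_corner_sym => tail_head.
by case: b t uv_conn {ru uv vr' vu vr''} => [] [].
Qed.

(** Under the assumption that the faces at x and y coincide, the inclusion of
    corners maps regions into regions.  By [corner_image_ex] it then reaches all
    regions except the digon. *)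
Lemma corner_image_connect c c' : connect (corner_adj D) (x, b, ~~ b) (y, b, ~~ b) ->
  connect (corner_adj D') c c' -> connect (corner_adj D) (corner_image c) (corner_image c').
Proof.
move=> xy_conn.
have step_conn c1 c2 : corner_step D' c1 c2 ->
    connect (corner_adj D) (corner_image c1) (corner_image c2).
  case/or3P.
  - move=> /existsP[[v s] /existsP[[w s'] /existsP[t /and3P[vw /eqP-> /eqP->]]]].
    rewrite !side_corner_image /pass_image /=.
    have Es' : s' = ~~ s by have := follows_alternate vw; case: s s' {vw} => [] [].
    subst s'; have [vw'|] := untwisted_step vw; first exact: connect_side_corner.
    have [px xy yp' pp'] := xy_side; have [qy yx xq' qq'] := yx_side.
    case=> -> [] [-> ->]; rewrite negbK; first exact: (twisted_side_corner _ xy_side).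
    by apply: (twisted_side_corner _ yx_side); rewrite // connect_corner_sym.
  - move=> /existsP[m /andP[/eqP-> /eqP->]]; apply: connect_corner_step; apply/or3P/Or32.
    by apply/existsP; exists m; rewrite /corner_image /= !g_marked !boundary_signE !eqxx.
  - move=> /existsP[m /andP[/eqP-> /eqP->]]; apply: connect_corner_step; apply/or3P/Or33.
    by apply/existsP; exists m; rewrite /corner_image /= !g_marked !boundary_signE !eqxx.
move=> /connectP[cs path_cs ->] {c'}.
elim: cs c path_cs => [|c1 cs IHcs] c //= /andP[cc1 /IHcs]; apply: connect_trans.
by case/orP: cc1 => /step_conn; rewrite // connect_corner_sym.
Qed.

Lemma corner_image_ex c : connect (corner_adj D) c (x, ~~ b, b) \/
  exists c', connect (corner_adj D) c (corner_image c').
Proof.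
have side_corner_ex u v r r' t t' : twisted_side g b u v r r' -> twisted_side g b v u t t' ->
    forall d0 d1,
    connect (corner_adj D) (v, d0, d1) (u, ~~ b, b) \/
    exists c', connect (corner_adj D) (v, d0, d1) (corner_image c').
  move=> [_ uv vr' _] [tv _ _ _] d0 d1.
  have [<-{d1}|d01] := eqVneq d0 d1; last first.
    have [d1b|d1b] := eqVneq d1 b.
      have -> : d0 = ~~ b by rewrite -d1b; case: d0 d1 d01 {d1b} => [] [].
      by left; rewrite d1b connect_corner_sym; apply: face_step_connect uv.
    have [-> ->] : d0 = b /\ d1 = ~~ b by case: d0 d1 b d01 d1b => [] [] [].
    right; exists (r', b, ~~ b).
    by have := face_step_connect vr'; rewrite negbK.
  right; case: d0; [exists (r', false, false) | exists (t, true, true)].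
    by have /eqP := end_region_step vr'; rewrite end_region_eq.
  by have /eqP := end_region_step tv; rewrite end_region_eq connect_corner_sym.
have [px xy yp' pp'] := xy_side; have [qy yx xq' qq'] := yx_side.
case: c => [[v d0] d1]; have [/codomP[v' ->]|] := boolP (v \in codom g).
  by right; exists (v', d0, d1).
rewrite codom_g negbK !inE => /orP[] /eqP ->; last exact: side_corner_ex xy_side yx_side _ _.
have [con|] := side_corner_ex _ _ _ _ _ _ yx_side xy_side d0 d1; last by right.
by left; apply: connect_trans con (face_step_connect yx).
Qed.

(** By Euler's formula the big diagram, having two more crossings, has two more
    regions; if the faces at x and y coincided, then it would have at most one
    more, the digon. *)
Lemma untwisted_faces_distinct : #|crossing D| = (#|crossing D'| + 2)%N ->
  ~~ connect (corner_adj D) (x, b, ~~ b) (y, b, ~~ b).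
Proof.
move=> card_crossing; apply/negP => xy_conn.
have [euler _ _ _ _] := postnikov_axioms D; have [euler' _ _ _ _] := postnikov_axioms D'.
suff : (n_comp (corner_adj D) predT <= (n_comp (corner_adj D') predT).+1)%N.
  by rewrite euler euler' card_crossing (addnAC _ 2 n) [(_ + 2 + 2)%N]addn2 ltnn.
pose roots_image := fingraph.root (corner_adj D) (x, ~~ b, b) ::
  [seq fingraph.root (corner_adj D) (corner_image c) | c <- enum (roots (corner_adj D'))].
apply: leq_trans (_ : size roots_image <= _)%N; last first.
  rewrite /= size_map -cardE ltnS; apply: subset_leq_card.
  by apply/subsetP => c; rewrite !inE andbT.
apply: leq_trans (card_size roots_image).
apply: subset_leq_card; apply/subsetP => c; rewrite inE andbT => /eqP root_c.
have rootP := fingraph.rootP (@connect_corner_sym n k D).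
rewrite inE; have [/rootP|[c' /rootP]] := corner_image_ex c; rewrite root_c => ->.
  by rewrite eqxx.
apply/orP; right; apply/mapP; exists (fingraph.root (corner_adj D') c').
  by rewrite mem_enum; apply: roots_root (@connect_corner_sym n k D') _.
by apply/rootP/corner_image_connect; rewrite ?connect_root.
Qed.

End Untwisting.

(** The face at u is left at t' and entered from r, and everything between them is
    kept; the lists for u and for v therefore fit together at both ends. *)
Lemma twisted_face (n k : nat) (D D' : postnikov_diagram n k) (g : point D' -> point D) b u v r r' t t' w :
  deletion g -> (forall z, (z \in codom g) = (z \notin [:: u; v])) ->
  twisted_side g b u v r r' -> twisted_side g b v u t t' ->
  face_boundary (~~ b) (u :: w) -> v \notin w ->
  exists w', [/\ w = map g (t' :: w'), uniq (t' :: w'),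
    path (face_step (~~ b)) t' w' & last t' w' = r].
Proof.
move=> del codom_g [ru _ _ _] [_ _ ut' _] /andP[/= /andP[uw Uw] path_w] vw.
have g_inj : injective g by case: del.
have [z zw|w0 Ew] := codom_seq (g := g) (c := w).
  by rewrite codom_g !inE negb_or; apply/andP; split; [apply: contraNneq uw | apply: contraNneq vw] => <-.
move: path_w Uw; rewrite Ew (map_inj_uniq g_inj).
case: w0 {Ew uw vw} => [/= /andP[uu _] _|a w' /=].
  by have := follows_neq uu; rewrite eqxx.
rewrite rcons_path => /and3P[ua path_w wu] Uw.
have at' : a = t' by apply: g_inj; apply: face_step_fun ua ut'.
subst a; exists w'; split=> //; first exact: (deletion_path del).
by apply: g_inj; rewrite last_map in wu; apply: face_step_inj wu ru.
Qed.

(** With w' and u' the paths completing x and y to their other faces, h sends x to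
    u' and y to w', and w' ++ u' is the merged face. *)
Lemma untwisting_dimer_iso (K : fieldType) (n k : nat) (D D' : postnikov_diagram n k) :
  untwisting D D' -> dimer_iso K D D'.
Proof.
move=> [f [x [y [b [i [j [s1 [s2 [t1 [t2 [[f_inj ij] [Di D'i] [Dj D'j] Dl bs]]]]]]]]]]].
have relabelE l : relabel f (passes D' l) = [seq c <- passes D l | c.1 \notin [:: x; y]].
  have [->|li] := eqVneq l i.
    by rewrite D'i; apply: (filter_segment (M := [:: (x, b); (y, ~~ b)])).
  have [->|lj] := eqVneq l j.
    rewrite D'j (filter_segment (M := [:: (y, b); (x, ~~ b)]) Dj).
    by apply: eq_filter => c; rewrite !inE orbC.
  rewrite (Dl _ li lj); apply/esym/all_filterP/allP => -[c d] cl /=.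
  have cij l' : (c, d) \in passes D l' -> (l' == i) || (l' == j) -> False.
    by move=> /(passes_inj cl) <-; rewrite (negPf li) (negPf lj).
  apply/negP; rewrite !inE => /orP[] /eqP Ec; rewrite Ec in cij.
    have [Ed|nd] := eqVneq d b.
      by apply: (cij i); rewrite ?eqxx // Di mem_cat Ed !inE eqxx !orbT.
    apply: (cij j); rewrite ?eqxx ?orbT // Dj mem_cat.
    have -> : d = ~~ b by case: d b nd {cl cij Di Dj} => [] [].
    by rewrite !inE eqxx !orbT.
  have [Ed|nd] := eqVneq d b.
    by apply: (cij j); rewrite ?eqxx ?orbT // Dj mem_cat Ed !inE eqxx !orbT.
  apply: (cij i); rewrite ?eqxx // Di mem_cat.
  have -> : d = ~~ b by case: d b nd {cl cij Di Dj} => [] [].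
  by rewrite !inE eqxx !orbT.
have xy : x != y by have := passes_uniq D i; rewrite Di !map_cat !cat_uniq /= !inE => /and4P[_ _ /andP[]].
have inl_xy c : ((inl c : point D) \in [:: inl x; inl y]) = (c \in [:: x; y]).
  by rewrite !inE !(inj_eq (@inl_inj _ 'I_n)).
pose g (v : point D') : point D := match v with inl z => inl (f z) | inr l => inr l end.
have g_inj : injective g by move=> [z1|l1] [z2|l2] //= [] => [/f_inj|] ->.
have codom_g v : (v \in codom g) = (v \notin [:: inl x; inl y]).
  apply/codomP/idP => [[[z|l] ->]|] //.
    by rewrite inl_xy; apply/(kept_crossing relabelE); exists z.
  case: v => [c|l]; last by exists (inr l).
  rewrite inl_xy => /(kept_crossing relabelE)[z ->].
  by exists (inl z).
have del : deletion g.
  split=> // l; rewrite (strand_image relabelE _ (fun=> erefl)) /strand /= filter_rcons !codom_g /= !bs.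
  congr (_ :: rcons _ _).
  rewrite filter_map; congr map; apply: eq_filter => c /=.
  by rewrite codom_g inl_xy.
have [p [p' xy_side]] := twisted_side_ex del codom_g Di.
have codom_g' v : (v \in codom g) = (v \notin [:: inl y; inl x]).
  by rewrite codom_g !inE orbC.
have [q [q' yx_side]] := twisted_side_ex del codom_g' Dj.
have card_crossing : #|crossing D| = (#|crossing D'| + 2)%N.
  have <- : #|[:: x; y]| = 2%N by apply/card_uniqP; rewrite /= inE xy.
  rewrite -(card_codom f_inj) addnC -(cardC (mem [:: x; y])); congr addn.
  apply: eq_card => c; transitivity (c \notin [:: x; y]); first by rewrite inE.
  by apply/(kept_crossing relabelE)/codomP.
have faces_distinct := untwisted_faces_distinct del codom_g xy_side yx_side (fun=> erefl) bs card_crossing.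
have [px xy_step yp' pp'] := xy_side; have [qy yx_step xq' qq'] := yx_side.
have digon_xy : face_boundary b [:: inl x; inl y].
  by apply/andP; split; [rewrite /= inE (inj_eq (@inl_inj _ 'I_n)) xy | apply/and3P].
have digon_yx : face_boundary b [:: inl y; inl x].
  by rewrite -[[:: _; _]]/([:: inl y] ++ [:: inl x]) face_boundary_catC.
have [w face_w] := @face_boundary_ex _ _ D (~~ b) (inl x) isT.
have [u face_u] := @face_boundary_ex _ _ D (~~ b) (inl y) isT.
have apart v : v \in inl x :: w -> v \in inl y :: u -> False.
  move=> vw vu; have := face_boundary_connect face_w (mem_head _ _) vw.
  have := face_boundary_connect face_u vu (mem_head _ _); rewrite !negbK => vy xv.
  by case/negP: faces_distinct; apply: connect_trans xv vy.
have yw : inl y \notin w by apply/negP => yw; apply: (apart (inl y)); rewrite inE ?yw ?eqxx ?orbT.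
have xu : inl x \notin u by apply/negP => xu; apply: (apart (inl x)); rewrite inE ?xu ?eqxx ?orbT.
have [w1 [Ew Uw path_w last_w]] := twisted_face del codom_g xy_side yx_side face_w yw.
have [u1 [Eu Uu path_u last_u]] := twisted_face del codom_g' yx_side xy_side face_u xu.
set w' := q' :: w1 in Ew Uw; set u' := p' :: u1 in Eu Uu.
have merged : face_boundary (D := D') (~~ b) (w' ++ u').
  apply/andP; split.
    rewrite cat_uniq Uw Uu andbT; apply/hasPn => z zu; apply/negP => zw.
    by apply: (apart (g z)); rewrite inE ?Ew ?Eu map_f ?orbT.
  by rewrite /= rcons_cat cat_path /= rcons_path last_w last_u; apply/and4P.
subst w u.
pose h := retract g (fun v => [:: v]) (fun e => if e == inl x then u' else w').
(* The head of x and the tail of y are the region at the head of q, whereas the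
   tail of x and the head of y are the region at the head of p. *)
pose rho (a : point D * bool) := retract g (fun v => (v, a.2))
  (fun e => (if (e == inl x) == a.2 then q else p, true)) a.1.
have xg : inl x \notin codom g by rewrite codom_g !inE eqxx.
have yg : inl y \notin codom g by rewrite codom_g !inE eqxx orbT.
have yx : (inl y == inl x :> point D) = false by rewrite (inj_eq (@inl_inj _ 'I_n)) eq_sym (negPf xy).
have h_g v : h (g v) = [:: v] := retract_image del _ _ v.
have h_x : h (inl x) = u' by rewrite /h retract_notin ?eqxx.
have h_y : h (inl y) = w' by rewrite /h retract_notin ?yx.
have rho_g v d : rho (g v, d) = (v, d) := retract_image del _ _ v.
have rho_x d : rho (inl x, d) = (if d then q else p, true).
  by rewrite /rho retract_notin // eqxx; case: d.
have rho_y d : rho (inl y, d) = (if d then p else q, true).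
  by rewrite /rho retract_notin // yx; case: d.
have h_map c : flatten (map h (map g c)) = c.
  by rewrite -map_comp (eq_map (g := fun v => [:: v])) ?flatten_map1 ?map_id // => v /=; apply: h_g.
have codom_cases v : [\/ v \in codom g, v = inl x | v = inl y].
  have [|] := boolP (v \in codom g); first by move=> _; apply: Or31.
  by rewrite codom_g negbK !inE => /orP[] /eqP ->; [apply: Or32 | apply: Or33].
have kept_face s z c : face_boundary s (g z :: c) -> inl x \notin c -> inl y \notin c ->
    exists c', c = map g c' /\ face_boundary s (z :: c').
  move=> fc xc yc; have [v vc|c' Ec] := codom_seq (g := g) (c := c).
    by rewrite codom_g !inE negb_or; apply/andP; split; [apply: contraNneq xc | apply: contraNneq yc] => <-.
  by exists c'; split=> //; apply: (deletion_face del); rewrite -Ec.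
(* Opened at a point z of w0 = l1 ++ z :: l2, the two faces are z, l2, e, l1 and
   z, l2, u0, l1. *)
have side_face e w0 u0 z : face_boundary (~~ b) (e :: map g w0) ->
    face_boundary (~~ b) (w0 ++ u0) -> h e = u0 -> z \in w0 ->
    exists Q, face_boundary (~~ b) (g z :: Q) /\ face_boundary (~~ b) (z :: flatten (map h Q)).
  move=> fe + he zw; case/splitPr: zw fe => l1 l2.
  rewrite map_cat -cat_cons face_boundary_catC /= => fz fz'.
  exists (map g l2 ++ e :: map g l1); split=> //.
  rewrite map_cat flatten_cat /= he !h_map catA -cat_cons -[(z :: _) ++ _]/((z :: l2 ++ u0) ++ _).
  by rewrite face_boundary_catC /= -[z :: _ ++ _]/((z :: l2) ++ u0) catA.
clearbody h rho.
apply: (@reduction_dimer_iso _ _ D D' K f g rho h) => //.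
- move=> s v u /(untwisted_step del codom_g xy_side yx_side) [/end_region_step //|].
  case=> _ [] [-> ->].
    (* Between p and p' the strand bounds the region that contains the tail of x and
       the head of y. *)
    rewrite (end_region_step px) -(end_region_step yx_step); exact: end_region_step yp'.
  rewrite (end_region_step qy) -(end_region_step xy_step); exact: end_region_step xq'.
- by move=> m; rewrite /= !bs; apply: end_region_boundary.
- move=> s v u vu.
  have Es : s = b \/ s = ~~ b by case: (s) (b) => [] []; [left | right | right | left].
  have [/codomP[v' Ev]|Ev|Ev] := codom_cases v; subst v.
  + rewrite rho_g; have [/codomP[t Et]|Et|Et] := codom_cases u; subst u.
    * by rewrite rho_g; apply: end_region_step (deletion_face_step del vu).
    * case: Es => Es; subst s.
        by move: yg; rewrite -(face_step_inj vu yx_step) codom_f.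
      by rewrite rho_x (g_inj _ _ (face_step_inj vu px)).
    * case: Es => Es; subst s.
        by move: xg; rewrite -(face_step_inj vu xy_step) codom_f.
      by rewrite rho_y (g_inj _ _ (face_step_inj vu qy)).
  + rewrite rho_x; case: Es => Es; subst s.
      by rewrite (face_step_fun vu xy_step) rho_y.
    by rewrite (face_step_fun vu xq') rho_g; apply: end_region_step qq'.
  + rewrite rho_y; case: Es => Es; subst s.
      by rewrite (face_step_fun vu yx_step) rho_x.
    by rewrite (face_step_fun vu yp') rho_g; apply: end_region_step pp'.
- by move=> m; rewrite -[inr m]/(g (inr m)) -[inr (ordS m)]/(g (inr (ordS m))) !rho_g -!bs; apply: end_region_boundary.
- move=> [v d]; have [/codomP[v' ->]|->|->] := codom_cases v; first by rewrite rho_g.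
    rewrite rho_x /=; case: d; last exact: end_region_step px.
    by rewrite (end_region_step qy) -(end_region_step xy_step).
  rewrite rho_y /=; case: d; last exact: end_region_step qy.
  by rewrite (end_region_step px) -(end_region_step yx_step).
- move=> e; have [/codomP[v' ->]|->|->] := codom_cases e; first by left; exists v'.
    by right; exists y, b; rewrite h_x.
  by right; exists x, b; rewrite h_y.
- move=> z s; have zg : g (inl z) \in codom g := codom_f _ _.
  have [Q face_Q] := @face_boundary_ex _ _ D s (g (inl z)) isT.
  have transfer c d : face_boundary s (inl x :: c) -> face_boundary s (inl y :: d) ->
      g (inl z) \notin inl x :: c -> g (inl z) \notin inl y :: d ->
      exists Q, face_boundary s (g (inl z) :: Q) /\
        face_boundary s (inl z :: flatten (map h Q)).
    move=> face_x face_y zx zy.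
    have [||Q' [EQ face_Q']] := kept_face _ _ _ face_Q.
    - exact: face_boundary_disjoint face_Q face_x zx.
    - exact: face_boundary_disjoint face_Q face_y zy.
    by exists Q; rewrite face_Q EQ h_map.
  have [Es|sb] := eqVneq s b.
    apply: (transfer [:: inl y] [:: inl x]); rewrite ?Es // -?codom_g -?codom_g' //.
  have {sb} Es : s = ~~ b by case: (s) (b) sb => [] [].
  subst s; have [zw|zw] := boolP (inl z \in w').
    exact: side_face face_w merged h_x zw.
  have [zu|zu] := boolP (inl z \in u').
    by apply: side_face face_u _ h_y zu; rewrite face_boundary_catC.
  apply: transfer face_w face_u _ _; rewrite inE negb_or (mem_map g_inj) ?zw ?zu andbT.
    by apply: contraNneq xg => <-.
  by apply: contraNneq yg => <-.
- move=> c; have [cxy|] := boolP (c \in [:: x; y]); last first.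
    by move/(kept_crossing relabelE); left.
  right; move: cxy; rewrite !inE => /orP[] /eqP ->.
    exists w' => s; have [->|sb] := eqVneq s b.
      by exists [:: inl y]; rewrite /= h_y cats0.
    have -> : s = ~~ b by case: (s) (b) sb => [] [].
    by exists (map g w'); rewrite h_map.
  exists u' => s; have [->|sb] := eqVneq s b.
    by exists [:: inl x]; rewrite /= h_x cats0.
  have -> : s = ~~ b by case: (s) (b) sb => [] [].
  by exists (map g u'); rewrite h_map.
Qed.

Theorem lemma12p1 (R : realType) (n k : nat) (D D' : postnikov_diagram n k) :
  [\/ untwisting D D', untwisting D' D,
      boundary_untwisting D D' | boundary_untwisting D' D] ->
  exists f : {lrmorphism dimer_algebra D R[i] -> dimer_algebra D' R[i]},
    bijective f.
Proof.
case=> [/(untwisting_dimer_iso R[i])|/(untwisting_dimer_iso R[i])|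
    /(boundary_untwisting_dimer_iso R[i])|/(boundary_untwisting_dimer_iso R[i])] [F [G [FK GK]]].
- by exists F, G.
- by exists G, F.
- by exists F, G.
- by exists G, F.
Qed.
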